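(* Let $\widehat{\mathcal M}'_T=\{(u,v)\in\mathbb C^2:e^{u}+e^{v}=1\}$ and let $L\colon\widehat{\mathcal M}'_T\to\mathbb C/4\pi^2\mathbb Z$ be the function constructed from spin Chern-Simons theory as in the context (with coordinates $(u,v)$ in place of $(u_1,u_2)$, and for any choice of nonzero flat section $\tau'$). Then the sum $$L(u_1,v_1)+L(u_2,v_2)+L(u_3,v_3)+L(u_4,v_4)+L(u_5,v_5)$$ is independent of the choice of points $(u_j,v_j)\in\widehat{\mathcal M}'_T$, $j\in\mathbb Z/5\mathbb Z$, which satisfy $$v_j=u_{j-1}+u_{j+1}\qquad\text{for all }j\in\mathbb Z/5\mathbb Z.$$
   Context: Write $i=\sqrt{-1}$. (In this context the standard coordinates on $\mathbb C^2$ are written $u_1,u_2$; in the claim they are written $u,v$.) Torus. $T=\mathbb R^2/\mathbb Z^2$ with coordinates $\theta^1,\theta^2$, oriented by $d\theta^1\wedge d\theta^2$, with the spin structure for which both coordinate loops inherit the bounding spin structure. The associated quadratic refinement of the intersection pairing is $\sigma(n_1,n_2)=n_1n_2\bmod 2$ on $H^1(T;\mathbb Z/2)$, in the standard basis. Moduli spaces. $\widehat{\mathcal M}_T=\mathbb C^2$ with coordinates $u_1,u_2$; $\mathcal M_T=(\mathbb C^\times)^2$ with coordinates $\mu_1,\mu_2$; $e\colon\widehat{\mathcal M}_T\to\mathcal M_T$, $e(u_1,u_2)=(e^{u_1},e^{u_2})$, a principal $\mathbb Z^2$-bundle. $\widehat{\mathcal M}'_T=\{e^{u_1}+e^{u_2}=1\}\subset\widehat{\mathcal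 M}_T$, $\mathcal M'_T=\{\mu_1+\mu_2=1\}\subset\mathcal M_T$, and $e'\colon\widehat{\mathcal M}'_T\to\mathcal M'_T$ is the restriction of $e$. Universal connection. On the trivial principal $\mathbb C^\times$-bundle $\widehat{\mathcal M}_T\times T\times\mathbb C^\times\to\widehat{\mathcal M}_T\times T$ with section $\hat t_0(u,\theta)=(u,\theta,1)$, let $\hat\eta$ be the connection with $\hat t_0^*\hat\eta=-u_1d\theta^1-u_2d\theta^2$. The action $(n_1,n_2)\cdot(u_1,u_2,\theta^1,\theta^2,\lambda)=(u_1+2\pi in_1,u_2+2\pi in_2,\theta^1,\theta^2,e^{2\pi i(n_1\theta^1+n_2\theta^2)}\lambda)$ of $\mathbb Z^2$ preserves $\hat\eta$, so the bundle with connection descends to $\rho\colon\mathcal Q\to\mathcal M_T\times T$ with connection $\eta$, of curvature $\Omega(\eta)$. It is flat along each $\{\mu\}\times T$. Spin Chern-Simons line bundle. $\mathcal L\to\mathcal M_T$ is the line bundle whose fiber at $\mu$ is the space of functions $f$ on the set of smooth sections $t$ of $\mathcal Q|_{\{\mu\}\times T}\to T$ satisfying $$f(t\cdot h)=(-1)^{\sigma([h])}\exp\Bigl(-\frac{i}{4\pi}\int_Tt^*\eta\wedge\frac{dh}{h}\Bigr)f(t)$$ for all smooth $h\colon T\to\mathbb C^\times$, where $[h]\in H^1(T;\mathbb Z/2)$ is the mod 2 reduction of the homotopy class of $h$. A section $t$ of $\mathcal Q$ over $U\times T$, $U\subset\mathcal M_T$ open, gives a trivialization $\tau_t$ of $\mathcal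 L|_U$ (the function with value $1$ at $t$), and the covariant derivative on $\mathcal L$ is determined by $\nabla\tau_t=\bigl(\frac{i}{4\pi}\int_Tt^*\eta\wedge\Omega(\eta)\bigr)\tau_t$ (integration over the fiber $T$). In the same way $\hat t_0$ gives a trivialization $\hat\tau_0$ of $e^*\mathcal L\to\widehat{\mathcal M}_T$. Let $\mathcal L'=\mathcal L|_{\mathcal M'_T}$ and let $\hat\tau_0'$ be the restriction of $\hat\tau_0$ to $\widehat{\mathcal M}'_T$. The function $L$. The bundle $\mathcal L'\to\mathcal M_T'$ is flat with trivial holonomy, so it has nonzero flat sections $\tau'$, unique up to a constant in $\mathbb C^\times$. For a choice of $\tau'$ set $\varphi=\hat\tau_0'/(e')^*\tau'\colon\widehat{\mathcal M}'_T\to\mathbb C^\times$ and define $L\colon\widehat{\mathcal M}'_T\to\mathbb C/4\pi^2\mathbb Z$ by $\varphi=\exp(L/2\pi i)$. Changing $\tau'$ changes $L$ by an additive constant. *)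

(* Defs.v *)
From Stdlib Require Export Reals ZArith.
From Coquelicot Require Export Coquelicot.

Open Scope C_scope.

Definition Cexp (z : C) : C :=
  ((exp (Re z) * cos (Im z))%R, (exp (Re z) * sin (Im z))%R).

Definition two_pi_i : C := RtoC (2 * PI) * Ci.

Section Calculus.
Context {E : NormedModule R_AbsRing}.

(** Meaningful only where both components are differentiable along the line. *)
Definition Dir (F : E -> C) (x v : E) : C :=
  (Derive (fun r : R => Re (F (plus x (scal r v)))) 0%R,
   Derive (fun r : R => Im (F (plus x (scal r v)))) 0%R).

Definition ex_Dir (F : E -> C) (x v : E) : Prop :=
  ex_derive (fun r : R => Re (F (plus x (scal r v)))) 0%R /\
  ex_derive (fun r : R => Im (F (plus x (scal r v)))) 0%R.

(** For [E] finite dimensional and [D] open, this is the usual class [C^k]. *)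
Fixpoint Ck (k : nat) (D : E -> Prop) (F : E -> C) : Prop :=
  (forall x, D x -> continuous (U := C_UniformSpace) F x) /\
  match k with
  | O => True
  | S k' => forall v : E,
      (forall x, D x -> ex_Dir F x v) /\ Ck k' D (fun x => Dir F x v)
  end.

Definition smooth (D : E -> Prop) (F : E -> C) : Prop := forall k, Ck k D F.

(** Complex-valued forms: an alternating multilinear function of tangent
    vectors at each point. *)
Definition form1 := E -> E -> C.
Definition form2 := E -> E -> E -> C.
Definition form3 := E -> E -> E -> E -> C.

Definition dlog (h : E -> C) : form1 := fun x v => Dir h x v / h x.

(** Exterior derivative, evaluated on constant vector fields. *)
Definition d1 (A : form1) : form2 := fun x v w =>
  Dir (fun y => A y w) x v - Dir (fun y => A y v) x w.

Definition wedge11 (A B : form1) : form2 := fun x v w =>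
  A x v * B x w - A x w * B x v.

Definition wedge12 (A : form1) (B : form2) : form3 := fun x v1 v2 v3 =>
  A x v1 * B x v2 v3 - A x v2 * B x v1 v3 + A x v3 * B x v1 v2.

End Calculus.

(** Functions on [T = R^2/Z^2] are represented by periodic functions on [R^2]. *)

Definition C2R : NormedModule R_AbsRing :=
  prod_NormedModule R_AbsRing C_R_NormedModule C_R_NormedModule.
Definition R2 : NormedModule R_AbsRing :=
  prod_NormedModule R_AbsRing R_NormedModule R_NormedModule.
Definition C2T : NormedModule R_AbsRing := prod_NormedModule R_AbsRing C2R R2.

Definition translate (m : Z * Z) (th : R * R) : R * R :=
  ((fst th + IZR (fst m))%R, (snd th + IZR (snd m))%R).

Definition periodic {V : Type} (F : R * R -> V) : Prop :=
  forall m th, F (translate m th) = F th.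

Definition smooth_T_Cstar (g : R * R -> C) : Prop :=
  smooth (E := R2) (fun _ => True) g /\ periodic g /\ (forall th, g th <> 0).

Definition Int_T (F : R * R -> C) : C :=
  RInt (V := C_R_CompleteNormedModule)
    (fun th1 : R =>
       RInt (V := C_R_CompleteNormedModule) (fun th2 : R => F (th1, th2)) 0 1)
    0 1.

(** [winding h n]: under [[T, C^x] = H^1(T; Z) = Z^2] (dual to the coordinate
    loops), the class of [h] is [n]. *)
Definition winding (h : R * R -> C) (n : Z * Z) : Prop :=
  RInt (V := C_R_CompleteNormedModule)
    (fun s : R => dlog (E := R2) h (s, 0%R) (1%R, 0%R)) 0 1
  = two_pi_i * RtoC (IZR (fst n)) /\
  RInt (V := C_R_CompleteNormedModule)
    (fun s : R => dlog (E := R2) h (0%R, s) (0%R, 1%R)) 0 1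
  = two_pi_i * RtoC (IZR (snd n)).

(** [(-1)^sigma(n)] for [sigma(n_1, n_2) = n_1 n_2 mod 2]. *)
Definition sign_sigma (n : Z * Z) : C :=
  if Z.even (fst n * snd n) then 1 else -1.

Definition MT (mu : C * C) : Prop := fst mu <> 0 /\ snd mu <> 0.
Definition MT' (mu : C * C) : Prop := MT mu /\ fst mu + snd mu = 1.
Definition e (u : C * C) : C * C := (Cexp (fst u), Cexp (snd u)).
Definition hatMT' (u : C * C) : Prop := Cexp (fst u) + Cexp (snd u) = 1.

(** A point [(u, theta, lambda)], with [theta] taken in [R^2]. *)
Definition hatQ : Type := ((C * C) * (R * R) * C)%type.

(** The action of [n] descends the bundle to [M_T], that of [m] presents
    [T = R^2/Z^2]. *)
Definition act (n m : Z * Z) (q : hatQ) : hatQ :=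
  let '(u, th, lam) := q in
  ((fst u + two_pi_i * RtoC (IZR (fst n)),
    snd u + two_pi_i * RtoC (IZR (snd n))),
   translate m th,
   Cexp (two_pi_i * RtoC (IZR (fst n) * fst th + IZR (snd n) * snd th)) * lam).

(** Points of [Q] are orbits in [hatQ]. *)
Definition Q : Type := hatQ -> Prop.
Definition orbit (q : hatQ) : Q := fun q' => exists n m, q' = act n m q.

(** The section [hat t_0 . g] of [Q] over [{e u} x T]. *)
Definition sec (u : C * C) (g : R * R -> C) : R * R -> Q :=
  fun th => orbit (u, th, g th).

Definition hat_t0 (u : C * C) : R * R -> Q := sec u (fun _ => 1).

Definition smooth_section_at (mu : C * C) (t : R * R -> Q) : Prop :=
  exists u g, e u = mu /\ smooth_T_Cstar g /\ t = sec u g.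

(** [(u, g)] is a smooth lift to [hatQ], over the open set [V], of the section
    [t] of [Q]; in particular [u] is a branch over [V] of the inverse of [e]. *)
Definition lift_over (V : C * C -> Prop) (t : C * C -> R * R -> Q)
    (u : C * C -> C * C) (g : (C * C) * (R * R) -> C) : Prop :=
  open V /\
  (forall mu, V mu -> e (u mu) = mu) /\
  smooth (E := C2R) V (fun mu => fst (u mu)) /\
  smooth (E := C2R) V (fun mu => snd (u mu)) /\
  smooth (E := C2T) (fun x => V (fst x)) g /\
  (forall mu, V mu -> periodic (fun th => g (mu, th))) /\
  (forall mu th, V mu -> g (mu, th) <> 0) /\
  (forall mu, V mu -> t mu = sec (u mu) (fun th => g (mu, th))).

Definition smooth_section (U : C * C -> Prop) (t : C * C -> R * R -> Q) : Prop :=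
  open U /\ (forall mu, U mu -> MT mu) /\
  forall mu, U mu ->
    exists V u g, (forall nu, V nu -> U nu) /\ V mu /\ lift_over V t u g.

(** Pullback of [hat eta = dlambda/lambda - u_1 dtheta^1 - u_2 dtheta^2] along
    [x |-> (u x, th x, g x)], where [th] is linear (so [d th = th]). *)
Definition pull_eta {E : NormedModule R_AbsRing}
    (u : E -> C * C) (th : E -> R * R) (g : E -> C) : form1 (E := E) :=
  fun x v => dlog g x v
    - fst (u x) * RtoC (fst (th v)) - snd (u x) * RtoC (snd (th v)).

(** [t^* eta] for the section [t = sec u g] over a single [{mu} x T]. *)
Definition eta_T (u : C * C) (g : R * R -> C) : form1 (E := R2) :=
  pull_eta (E := R2) (fun _ => u) (fun th => th) g.

(** [t^* eta] over [V x T], for a section with lift [(u, g)]. *)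
Definition eta_VT (u : C * C -> C * C) (g : (C * C) * (R * R) -> C) :
    form1 (E := C2T) :=
  pull_eta (E := C2T) (fun x => u (fst x)) (fun x => snd x) g.

(** [f] is in the fiber of the Chern-Simons line bundle at [mu]. Only the values
    of [f] on the smooth sections over [{mu} x T] matter. Since [h] has exactly
    one winding [n], the quantification over [n] only names it. *)
Definition fiberL (mu : C * C) (f : (R * R -> Q) -> C) : Prop :=
  forall u g h n, e u = mu -> smooth_T_Cstar g -> smooth_T_Cstar h ->
    winding h n ->
    f (sec u (fun th => g th * h th)) =
    sign_sigma n *
    Cexp (- (Ci / RtoC (4 * PI)) *
          Int_T (fun th => wedge11 (eta_T u g) (dlog (E := R2) h) th
                             (1%R, 0%R) (0%R, 1%R))) *
    f (sec u g).

(** [f] is the value at [mu] of the trivialization [tau_t]. *)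
Definition is_tau (mu : C * C) (t : R * R -> Q) (f : (R * R -> Q) -> C) : Prop :=
  fiberL mu f /\ f t = 1.

(** The value at the tangent vector [X] to [M_T] at [mu] of the connection form
    [i/(4 pi) int_T t^* eta /\ Omega(eta)]; as [C^x] is abelian,
    [t^* Omega(eta) = d (t^* eta)]. *)
Definition conn_form (u : C * C -> C * C) (g : (C * C) * (R * R) -> C)
    (mu X : C * C) : C :=
  let A := eta_VT u g in
  let zero2 : C * C := (RtoC 0, RtoC 0) in
  Ci / RtoC (4 * PI) *
  Int_T (fun th =>
    wedge12 A (d1 A) (mu, th) (X, (0%R, 0%R))
      (zero2, (1%R, 0%R)) (zero2, (0%R, 1%R))).

(** The global chart [C \ {0,1} -> M'_T], and its differential. *)
Definition chart (z : C) : C * C := (z, 1 - z).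
Definition dchart (xi : C) : C * C := (xi, - xi).

(** [tau] is a smooth flat section of [L' -> M'_T]. If [t] is a section of [Q]
    over [U x T], then [tau = s tau_t] over [U] intersected with [M'_T], where
    [s mu = tau mu (t mu)], and flatness says [ds + s conn_form = 0]. *)
Definition flat_section (tau : C * C -> (R * R -> Q) -> C) : Prop :=
  (forall mu, MT' mu -> fiberL mu (tau mu)) /\
  forall U t, smooth_section U t ->
    let s := fun z : C => tau (chart z) (t (chart z)) in
    smooth (E := C_R_NormedModule) (fun z => U (chart z)) s /\
    forall V u g, (forall mu, V mu -> U mu) -> lift_over V t u g ->
      forall z xi, V (chart z) ->
        Dir (E := C_R_NormedModule) s z xi
        + conn_form u g (chart z) (dchart xi) * s z = 0.

Definition nonzero_section (tau : C * C -> (R * R -> Q) -> C) : Prop :=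
  exists mu t, MT' mu /\ smooth_section_at mu t /\ tau mu t <> 0.

(** [phi = hat tau_0' / (e')^* tau], i.e. [phi . (e')^* tau = hat tau_0']. *)
Definition is_ratio (tau : C * C -> (R * R -> Q) -> C) (phi : C * C -> C) : Prop :=
  forall p, hatMT' p ->
    is_tau (e p) (hat_t0 p) (fun t => phi p * tau (e p) t).

(** Equality in [C / 4 pi^2 Z]. *)
Definition eq_mod_4pi2 (z w : C) : Prop :=
  exists k : Z, z = w + RtoC (4 * PI ^ 2 * IZR k).

(** [L] takes its values in [C / 4 pi^2 Z], here through arbitrary (not
    necessarily continuous) representatives in [C]; note that
    [exp (z / 2 pi i) = exp (w / 2 pi i)] if and only if [eq_mod_4pi2 z w]. *)
Definition is_L (L : C * C -> C) : Prop :=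
  exists tau phi, flat_section tau /\ nonzero_section tau /\ is_ratio tau phi /\
    forall p, hatMT' p -> phi p = Cexp (L p / two_pi_i).

(** [p j = (u_j, v_j)] for [j = 0, ..., 4], with indices modulo 5. *)
Definition five_term (p : nat -> C * C) : Prop :=
  forall j, (j < 5)%nat ->
    hatMT' (p j) /\
    snd (p j) = fst (p ((j + 4) mod 5)%nat) + fst (p ((j + 1) mod 5)%nat).

(* Main.v *)
(* In logarithmic coordinates [(u, v)] flatness of [tau] gives
   [dL = (u dv - v du) / 2], and if [v_j = u_{j-1} + u_{j+1}] the sum over [j] of
   [u_j dv_j - v_j du_j] telescopes to 0; so the sum of the [L (u_j, v_j)] is locally
   constant.  A shift [u_j -> u_j + 2 pi i n_j] multiplies the section
   [(e')^* tau / hat tau_0'] at the [j]-th point by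
   [(-1)^(n_j (n_{j-1} + n_{j+1})) exp ((u_j (n_{j-1} + n_{j+1}) - v_j n_j) / 2)]; over
   the five points the exponents cancel in the same way and the signs cancel in pairs,
   so the product descends to the variety [1 - x_j = x_{j-1} x_{j+1}].  The latter is
   the complement of five lines in the plane of [(x_0, x_1)], where any two points
   are joined by an arc. *)

Require Import Defs.
From Stdlib Require Import Lra Lia FunctionalExtensionality PropExtensionality Classical.

(** The quantity followed throughout is [hat_value], the reciprocal of [phi]. Representatives of [L]
    may jump, so [L] itself is never differentiated; it enters only through [exp (L / 2 pi i)]. This
    is also where the factor 1/2 comes from: flatness gives [i / (4 pi) (u dv - v du)] for the
    logarithmic derivative of [hat_value], and passing to [L] multiplies by [- 2 pi i].

    Flatness is tested on sections [hat_t0] taken along a branch of the inverse of [e]. Their lift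
    has fibre coordinate 1, so both the connection form and the deck factor are integrals over [T]
    of constants. A deck transformation by [n] acts on [hat_t0] as the gauge transformation [exp (-
    2 pi i (n_1 theta^1 + n_2 theta^2))], whose winding produces the sign.

    On the five-term variety a straight segment between two points may cross a removed line, which
    is why bent arcs are used. The logarithms continued along an arc may also end on another sheet
    than the prescribed one, and the integers [n_j] absorb that difference. *)

(** * The complex exponential and its periods *)

Lemma Cexp_plus (z w : C) : Cexp (z + w) = Cexp z * Cexp w.
Proof.
  unfold Cexp, Cmult, Re, Im; simpl.
  rewrite exp_plus, cos_plus, sin_plus.
  f_equal; ring.
Qed.

Lemma Cexp_0 : Cexp 0 = 1.
Proof.
  unfold Cexp, Re, Im; simpl.
  rewrite exp_0, cos_0, sin_0.
  apply injective_projections; simpl; ring.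
Qed.

Lemma Cexp_opp_l (z : C) : Cexp (- z) * Cexp z = 1.
Proof.
  rewrite <- Cexp_plus.
  replace (- z + z) with (RtoC 0) by ring.
  apply Cexp_0.
Qed.

Lemma Cexp_neq_0 (z : C) : Cexp z <> 0.
Proof.
  intros H.
  apply C1_nz.
  rewrite <- (Cexp_opp_l z), H; ring.
Qed.

Lemma Cexp_opp (z : C) : Cexp (- z) = / Cexp z.
Proof.
  transitivity (Cexp (- z) * Cexp z * / Cexp z).
  - field; apply Cexp_neq_0.
  - rewrite Cexp_opp_l; ring.
Qed.

Lemma Cexp_minus (z w : C) : Cexp (z - w) = Cexp z / Cexp w.
Proof. unfold Cminus; rewrite Cexp_plus, Cexp_opp; reflexivity. Qed.

Lemma Cexp_eq_1 (z : C) :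
  Cexp z = 1 <-> exists k : Z, z = two_pi_i * RtoC (IZR k).
Proof.
  split.
  - destruct z as [x y]; unfold Cexp, Re, Im; simpl; intros H.
    injection H as Hc Hs.
    pose proof (exp_pos x) as Hx.
    assert (Hy : sin y = 0%R) by (apply Rmult_integral in Hs as [|]; lra).
    assert (Hcos : cos y = 1%R).
    { pose proof (sin2_cos2 y) as H1; unfold Rsqr in H1.
      rewrite Hy in H1.
      assert (H2 : (0 < cos y)%R) by nra.
      nra. }
    assert (Hx0 : x = 0%R).
    { rewrite Hcos, Rmult_1_r in Hc; rewrite <- (ln_exp x), Hc; apply ln_1. }
    (* Halving the angle gives the right period: [sin y = 0] alone leaves multiples of [PI], while
       [cos y = 1] forces [sin (y / 2) = 0]. *)
    replace y with (2 * (y / 2))%R in Hcos by field.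
    rewrite cos_2a_sin in Hcos.
    assert (Hh : sin (y / 2) = 0%R) by nra.
    apply sin_eq_0_0 in Hh as [k Hk].
    exists k.
    apply injective_projections; simpl; lra.
  - intros [k ->].
    assert (Hk : sin (IZR k * PI) = 0%R) by (apply sin_eq_0_1; exists k; reflexivity).
    unfold Cexp, Re, Im; simpl.
    replace (_ - _)%R with 0%R by ring.
    replace (_ + _)%R with (2 * (IZR k * PI))%R by ring.
    rewrite exp_0, sin_2a, cos_2a_sin, Hk.
    apply injective_projections; simpl; ring.
Qed.

Lemma Cexp_inj (z w : C) :
  Cexp z = Cexp w -> exists k : Z, z = w + two_pi_i * RtoC (IZR k).
Proof.
  intros H.
  destruct (proj1 (Cexp_eq_1 (z - w))) as [k Hk].
  { rewrite Cexp_minus, H; field; apply Cexp_neq_0. }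
  exists k; rewrite <- Hk; ring.
Qed.

Lemma two_pi_i_neq_0 : two_pi_i <> 0.
Proof.
  apply Cmult_neq_0; [|apply Ci_nz].
  pose proof PI_RGT_0; intros H1; apply RtoC_inj in H1; lra.
Qed.

(** * Curves in the complex plane *)

(** Taken componentwise to match [Dir], so that directional derivatives become its instance at 0
    along a line. *)
Definition is_cderive (f : R -> C) (t : R) (d : C) : Prop :=
  is_derive (fun r => Re (f r)) t (Re d) /\ is_derive (fun r => Im (f r)) t (Im d).

Lemma is_derive_eq (f : R -> R) (t a b : R) :
  is_derive f t a -> a = b -> is_derive f t b.
Proof. intros H <-; exact H. Qed.

Lemma is_derive_Rmult (f g : R -> R) (t a b : R) :
  is_derive f t a -> is_derive g t b ->
  is_derive (fun r => f r * g r)%R t (a * g t + f t * b)%R.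
Proof.
  intros Hf Hg.
  apply (is_derive_mult f g t a b Hf Hg Rmult_comm).
Qed.

Lemma is_cderive_eq (f : R -> C) (t : R) (a b : C) :
  is_cderive f t a -> a = b -> is_cderive f t b.
Proof. intros H <-; exact H. Qed.

Lemma is_cderive_ext_loc (f g : R -> C) (t : R) (a : C) :
  locally t (fun r => f r = g r) -> is_cderive f t a -> is_cderive g t a.
Proof.
  intros H [H1 H2]; split; eapply is_derive_ext_loc; eauto;
    revert H; apply filter_imp; intros r ->; reflexivity.
Qed.

Lemma is_cderive_ext (f g : R -> C) (t : R) (a : C) :
  (forall r, f r = g r) -> is_cderive f t a -> is_cderive g t a.
Proof.
  intros H; apply is_cderive_ext_loc, filter_forall, H.
Qed.

Lemma is_cderive_unique (f : R -> C) (t : R) (a b : C) :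
  is_cderive f t a -> is_cderive f t b -> a = b.
Proof.
  intros [H1 H2] [H3 H4].
  apply is_derive_unique in H1, H2, H3, H4.
  apply injective_projections; unfold Re, Im in *; congruence.
Qed.

Lemma is_cderive_const (c : C) (t : R) : is_cderive (fun _ => c) t 0.
Proof.
  split; [exact (@is_derive_const R_AbsRing R_NormedModule (Re c) t)
         |exact (@is_derive_const R_AbsRing R_NormedModule (Im c) t)].
Qed.

Lemma is_cderive_plus (f g : R -> C) (t : R) (a b : C) :
  is_cderive f t a -> is_cderive g t b ->
  is_cderive (fun r => f r + g r) t (a + b).
Proof.
  intros [H1 H2] [H3 H4].
  split; [exact (is_derive_plus _ _ _ _ _ H1 H3)
         |exact (is_derive_plus _ _ _ _ _ H2 H4)].
Qed.

Lemma is_cderive_opp (f : R -> C) (t : R) (a : C) :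
  is_cderive f t a -> is_cderive (fun r => - f r) t (- a).
Proof.
  intros [H1 H2].
  split; [exact (is_derive_opp _ _ _ H1)|exact (is_derive_opp _ _ _ H2)].
Qed.

Lemma is_cderive_minus (f g : R -> C) (t : R) (a b : C) :
  is_cderive f t a -> is_cderive g t b ->
  is_cderive (fun r => f r - g r) t (a - b).
Proof.
  intros Hf Hg; apply is_cderive_plus; [|apply is_cderive_opp]; assumption.
Qed.

Lemma is_cderive_mult (f g : R -> C) (t : R) (a b : C) :
  is_cderive f t a -> is_cderive g t b ->
  is_cderive (fun r => f r * g r) t (a * g t + f t * b).
Proof.
  intros [H1 H2] [H3 H4]; split.
  - eapply is_derive_eq.
    + exact (is_derive_minus _ _ _ _ _ (is_derive_Rmult _ _ _ _ _ H1 H3)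
               (is_derive_Rmult _ _ _ _ _ H2 H4)).
    + unfold minus, plus, opp, Re, Im; simpl; ring.
  - eapply is_derive_eq.
    + exact (is_derive_plus _ _ _ _ _ (is_derive_Rmult _ _ _ _ _ H1 H4)
               (is_derive_Rmult _ _ _ _ _ H2 H3)).
    + unfold minus, plus, opp, Re, Im; simpl; ring.
Qed.

Lemma is_cderive_scal (c : C) (f : R -> C) (t : R) (a : C) :
  is_cderive f t a -> is_cderive (fun r => c * f r) t (c * a).
Proof.
  intros H; eapply is_cderive_eq.
  - apply is_cderive_mult; [apply is_cderive_const|exact H].
  - cbv beta; ring.
Qed.

Lemma is_cderive_exp (f : R -> C) (t : R) (a : C) :
  is_cderive f t a -> is_cderive (fun r => Cexp (f r)) t (a * Cexp (f t)).
Proof.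
  intros [H1 H2].
  split; unfold Cexp; cbn [Re Im fst snd].
  - eapply is_derive_eq.
    + apply is_derive_Rmult.
      * exact (is_derive_comp exp _ _ _ _ (is_derive_exp _) H1).
      * exact (is_derive_comp cos _ _ _ _ (is_derive_cos _) H2).
    + unfold scal; simpl; unfold mult; simpl; unfold Re, Im; simpl; ring.
  - eapply is_derive_eq.
    + apply is_derive_Rmult.
      * exact (is_derive_comp exp _ _ _ _ (is_derive_exp _) H1).
      * exact (is_derive_comp sin _ _ _ _ (is_derive_sin _) H2).
    + unfold scal; simpl; unfold mult; simpl; unfold Re, Im; simpl; ring.
Qed.

Lemma Csqr_pos (z : C) : z <> 0 -> (0 < fst z ^ 2 + snd z ^ 2)%R.
Proof.
  intros Hz.
  destruct (Req_dec (fst z) 0) as [H1|H1], (Req_dec (snd z) 0) as [H2|H2]; try nra.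
  destruct Hz; apply injective_projections; assumption.
Qed.

(** Both components of an inverse [1 / f] have this shape, with denominator [|f|^2]. *)
Lemma is_derive_quot_sqr (p q r : R -> R) (t p' q' r' : R) :
  (0 < q t ^ 2 + r t ^ 2)%R ->
  is_derive p t p' -> is_derive q t q' -> is_derive r t r' ->
  is_derive (fun s => p s / (q s ^ 2 + r s ^ 2))%R t
    ((p' * (q t ^ 2 + r t ^ 2) - p t * (2 * q t * q' + 2 * r t * r'))
     / (q t ^ 2 + r t ^ 2) ^ 2)%R.
Proof.
  intros Hpos Hp Hq Hr.
  eapply is_derive_eq.
  - apply is_derive_div; [exact Hp| |lra].
    exact (is_derive_plus _ _ _ _ _ (is_derive_pow _ 2 _ _ Hq) (is_derive_pow _ 2 _ _ Hr)).
  - unfold plus; simpl; field; lra.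
Qed.

Lemma is_cderive_inv (f : R -> C) (t : R) (a : C) :
  f t <> 0 -> is_cderive f t a -> is_cderive (fun r => / f r) t (- (a / (f t * f t))).
Proof.
  intros Hf [H1 H2].
  pose proof (Csqr_pos _ Hf) as Hp.
  (* This is [|f^2|^2 = |f|^4], the denominator that appears when [a / (f * f)] is split into
     components. *)
  assert (Hq : ((fst (f t) * fst (f t) - snd (f t) * snd (f t)) ^ 2
    + (fst (f t) * snd (f t) + snd (f t) * fst (f t)) ^ 2 <> 0)%R).
  { replace (_ + _)%R with ((fst (f t) ^ 2 + snd (f t) ^ 2) ^ 2)%R by ring.
    apply pow_nonzero; lra. }
  split.
  - eapply is_derive_eq.
    + exact (is_derive_quot_sqr _ _ _ _ _ _ _ Hp H1 H1 H2).
    + unfold Re, Im; simpl; field; simpl in *; split; lra.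
  - eapply is_derive_eq.
    + exact (is_derive_quot_sqr _ _ _ _ _ _ _ Hp (is_derive_opp _ _ _ H2) H1 H2).
    + unfold opp, Re, Im; simpl; field; simpl in *; split; lra.
Qed.

Lemma is_derive_0_const (f : R -> R) (a b : R) :
  (forall t, is_derive f t 0%R) -> f a = f b.
Proof.
  intros H; destruct (Rtotal_order a b) as [Hab|[->|Hab]]; [|reflexivity|symmetry];
    apply (eq_is_derive f); auto; intros t _; apply H.
Qed.

Lemma is_cderive_0_const (f : R -> C) (a b : R) :
  (forall t, is_cderive f t 0) -> f a = f b.
Proof.
  intros H; apply injective_projections.
  - apply (is_derive_0_const (fun r => Re (f r))), H.
  - apply (is_derive_0_const (fun r => Im (f r))), H.
Qed.

Lemma is_cderive_affine (a b : C) (t : R) :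
  is_cderive (fun r => a + RtoC r * b) t b.
Proof.
  split; unfold Re, Im; simpl; auto_derive; auto; ring.
Qed.

Lemma is_cderive_inv_pow (f : R -> C) (t : R) (a : C) (n : nat) :
  f t <> 0 -> is_cderive f t a ->
  is_cderive (fun r => (/ f r) ^ n) t (- RtoC (INR n) * a * (/ f t) ^ S n).
Proof.
  intros Hf H; induction n as [|n IH].
  - apply (is_cderive_ext (fun _ => RtoC 1)); [reflexivity|].
    apply (is_cderive_eq _ _ 0); [apply is_cderive_const|].
    simpl INR; ring.
  - apply (is_cderive_ext (fun r => / f r * (/ f r) ^ n)); [reflexivity|].
    eapply is_cderive_eq.
    + exact (is_cderive_mult _ _ _ _ _ (is_cderive_inv _ _ _ Hf H) IH).
    + rewrite S_INR, RtoC_plus, !Cpow_S; field; exact Hf.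
Qed.

(** * Directional derivatives and smoothness *)

Section Smoothness.
Context {E : NormedModule R_AbsRing}.

Definition is_Dir (F : E -> C) (x v : E) (d : C) : Prop :=
  is_cderive (fun r => F (plus x (scal r v))) 0 d.

Lemma is_Dir_ex (F : E -> C) (x v : E) (d : C) : is_Dir F x v d -> ex_Dir F x v.
Proof. intros [H1 H2]; split; eexists; eassumption. Qed.

Lemma is_Dir_unique (F : E -> C) (x v : E) (d : C) : is_Dir F x v d -> Dir F x v = d.
Proof.
  intros [H1 H2]; apply injective_projections; simpl;
    apply is_derive_unique; assumption.
Qed.

Lemma Dir_correct (F : E -> C) (x v : E) : ex_Dir F x v -> is_Dir F x v (Dir F x v).
Proof.
  intros [H1 H2]; split; apply Derive_correct; assumption.
Qed.

Lemma line_0 (x v : E) : plus x (scal 0%R v) = x.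
Proof.
  transitivity (plus x zero); [f_equal; exact (scal_zero_l v)|apply plus_zero_r].
Qed.

(** A short piece of each line through a point of an open set stays in the set, so directional
    derivatives there depend only on values in the set. *)
Lemma locally_line (D : E -> Prop) (x v : E) :
  open D -> D x -> locally 0%R (fun r : R => D (plus x (scal r v))).
Proof.
  intros HD Hx.
  assert (Hc : continuous (fun r : R => plus x (scal r v)) 0%R).
  { apply @continuous_plus; [apply continuous_const|].
    apply @continuous_scal_l, continuous_id. }
  apply (Hc D), HD.
  rewrite line_0; exact Hx.
Qed.

Lemma is_Dir_ext (D : E -> Prop) (F G : E -> C) (x v : E) (d : C) :
  open D -> D x -> (forall y, D y -> F y = G y) -> is_Dir F x v d -> is_Dir G x v d.
Proof.
  intros HD Hx HFG.
  apply is_cderive_ext_loc.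
  generalize (locally_line D x v HD Hx); apply filter_imp; intros r; apply HFG.
Qed.

Lemma Ck_ext (k : nat) (D : E -> Prop) (F G : E -> C) :
  open D -> (forall x, D x -> F x = G x) -> Ck k D F -> Ck k D G.
Proof.
  intros HD; revert F G; induction k as [|k IH]; intros F G HFG [Hc Hk]; split.
  1, 3: intros x Hx; apply (continuous_ext_loc (U := C_UniformSpace) G F x); [|apply Hc, Hx];
    generalize (HD x Hx); apply filter_imp; intros y Hy; apply HFG, Hy.
  - exact I.
  - intros v; destruct (Hk v) as [He Hd]; split.
    + intros x Hx.
      apply (is_Dir_ex _ _ _ (Dir F x v)), (is_Dir_ext D F); auto.
      apply Dir_correct, He, Hx.
    + apply (IH (fun x => Dir F x v)); [|exact Hd].
      intros x Hx; symmetry; apply is_Dir_unique, (is_Dir_ext D F); auto.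
      apply Dir_correct, He, Hx.
Qed.

(** Induction on the order: every directional derivative of a member of [P] agrees on [D] with
    another member, to which the induction hypothesis applies. A smoothness proof then only has to
    name a suitable class, without formulas for iterated derivatives. *)
Lemma smooth_of_stable_class (D : E -> Prop) (P : (E -> C) -> Prop) :
  open D ->
  (forall F, P F ->
    (forall x, D x -> continuous (U := C_UniformSpace) F x) /\
    forall v, exists G, P G /\ forall x, D x -> is_Dir F x v (G x)) ->
  forall F, P F -> smooth D F.
Proof.
  intros HD HP F HF k; revert F HF.
  induction k as [|k IH]; intros F HF; destruct (HP F HF) as [Hc Hd];
    split; try assumption; [exact I|].
  intros v; destruct (Hd v) as [G [HG HFG]]; split.
  - intros x Hx; eapply is_Dir_ex, HFG, Hx.
  - apply (Ck_ext k D G); [exact HD| |apply IH, HG].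
    intros x Hx; symmetry; apply is_Dir_unique, HFG, Hx.
Qed.

Lemma is_Dir_const (c : C) (x v : E) : is_Dir (fun _ => c) x v 0.
Proof. apply is_cderive_const. Qed.

Lemma smooth_const (D : E -> Prop) (c : C) : open D -> smooth D (fun _ => c).
Proof.
  intros HD.
  apply (smooth_of_stable_class D (fun F => exists c, F = fun _ => c)); eauto.
  intros F [c' ->]; split.
  - intros; apply continuous_const.
  - intros v; exists (fun _ => RtoC 0); split; eauto.
    intros; apply is_Dir_const.
Qed.

End Smoothness.

(** * Continuity of complex-valued functions *)

Lemma continuous_C {U : UniformSpace} (F : U -> C) (x : U) :
  continuous (fun y => Re (F y)) x -> continuous (fun y => Im (F y)) x ->
  continuous (U := C_UniformSpace) F x.
Proof.
  intros H1 H2.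
  apply (continuous_ext (U := C_UniformSpace) (fun y => (Re (F y), Im (F y)))).
  { intros y; symmetry; apply surjective_pairing. }
  apply (continuous_comp_2 (W := R_UniformSpace) (X := C_UniformSpace)
    (fun y => Re (F y)) (fun y => Im (F y)) (fun a b => (a, b)) x H1 H2).
  apply (continuous_ext (fun p : R * R => p)); [intros []; reflexivity|].
  apply continuous_id.
Qed.

Lemma continuous_Re {U : UniformSpace} (F : U -> C) (x : U) :
  continuous (U := C_UniformSpace) F x -> continuous (fun y => Re (F y)) x.
Proof.
  intros H.
  apply (continuous_comp (V := C_UniformSpace) F (fun z : C => fst z)); [exact H|].
  destruct (F x); apply (@continuous_fst R_UniformSpace R_UniformSpace).
Qed.

Lemma continuous_Im {U : UniformSpace} (F : U -> C) (x : U) :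
  continuous (U := C_UniformSpace) F x -> continuous (fun y => Im (F y)) x.
Proof.
  intros H.
  apply (continuous_comp (V := C_UniformSpace) F (fun z : C => snd z)); [exact H|].
  destruct (F x); apply (@continuous_snd R_UniformSpace R_UniformSpace).
Qed.

Lemma continuous_Cplus {U : UniformSpace} (F G : U -> C) (x : U) :
  continuous (U := C_UniformSpace) F x -> continuous (U := C_UniformSpace) G x ->
  continuous (U := C_UniformSpace) (fun y => F y + G y) x.
Proof.
  intros HF HG; apply (continuous_plus (V := C_R_NormedModule) F G x HF HG).
Qed.

Lemma continuous_Cmult {U : UniformSpace} (F G : U -> C) (x : U) :
  continuous (U := C_UniformSpace) F x -> continuous (U := C_UniformSpace) G x ->
  continuous (U := C_UniformSpace) (fun y => F y * G y) x.
Proof.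
  intros HF HG.
  apply continuous_Re in HF as F1; apply continuous_Im in HF as F2.
  apply continuous_Re in HG as G1; apply continuous_Im in HG as G2.
  apply continuous_C; unfold Cmult; cbn [Re Im fst snd].
  - exact (continuous_minus _ _ x (continuous_mult _ _ x F1 G1)
             (continuous_mult _ _ x F2 G2)).
  - exact (continuous_plus _ _ x (continuous_mult _ _ x F1 G2)
             (continuous_mult _ _ x F2 G1)).
Qed.

Lemma continuous_real_comp {U : UniformSpace} (f : R -> R) (g : U -> R) (x : U) :
  ex_derive f (g x) -> continuous g x -> continuous (fun y => f (g y)) x.
Proof.
  intros Hf Hg; apply continuous_comp; [exact Hg|].
  apply ex_derive_continuous in Hf; exact Hf.
Qed.

Lemma continuous_norm_sqr {U : UniformSpace} (F : U -> C) (x : U) :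
  continuous (U := C_UniformSpace) F x ->
  continuous (fun y => fst (F y) ^ 2 + snd (F y) ^ 2)%R x.
Proof.
  intros HF.
  apply (continuous_plus (V := R_NormedModule));
    apply (continuous_real_comp (fun r => r ^ 2)%R);
    try (auto_derive; exact I); [apply continuous_Re, HF|apply continuous_Im, HF].
Qed.

Lemma continuous_Cinv {U : UniformSpace} (F : U -> C) (x : U) :
  F x <> 0 -> continuous (U := C_UniformSpace) F x ->
  continuous (U := C_UniformSpace) (fun y => / F y) x.
Proof.
  intros Hx HF; pose proof (Csqr_pos _ Hx).
  assert (Hi : continuous (fun y => / (fst (F y) ^ 2 + snd (F y) ^ 2))%R x).
  { apply (continuous_real_comp Rinv).
    - auto_derive; simpl in *; lra.
    - apply continuous_norm_sqr, HF. }
  apply continuous_C; unfold Cinv; cbn [Re Im fst snd].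
  - apply (continuous_mult (K := R_AbsRing)); [apply continuous_Re, HF|exact Hi].
  - apply (continuous_mult (K := R_AbsRing)); [|exact Hi].
    apply (continuous_opp (V := R_NormedModule)), continuous_Im, HF.
Qed.

Lemma continuous_Cpow {U : UniformSpace} (F : U -> C) (n : nat) (x : U) :
  continuous (U := C_UniformSpace) F x ->
  continuous (U := C_UniformSpace) (fun y => F y ^ n) x.
Proof.
  intros HF; induction n as [|n IH]; simpl.
  - apply continuous_const.
  - apply continuous_Cmult; assumption.
Qed.

Lemma continuous_Cexp {U : UniformSpace} (F : U -> C) (x : U) :
  continuous (U := C_UniformSpace) F x ->
  continuous (U := C_UniformSpace) (fun y => Cexp (F y)) x.
Proof.
  intros HF; apply continuous_C; unfold Cexp; cbn [Re Im fst snd];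
    apply (continuous_mult (K := R_AbsRing)).
  1, 3: apply (continuous_real_comp exp); [auto_derive; exact I|apply continuous_Re, HF].
  - apply (continuous_real_comp cos); [auto_derive; exact I|apply continuous_Im, HF].
  - apply (continuous_real_comp sin); [auto_derive; exact I|apply continuous_Im, HF].
Qed.

(** * The logarithm on the right half-plane *)

Definition Log (w : C) : C := (ln (fst w ^ 2 + snd w ^ 2) / 2, atan (snd w / fst w))%R.

Lemma Cexp_Log (w : C) : (0 < Re w)%R -> Cexp (Log w) = w.
Proof.
  destruct w as [a b]; unfold Cexp, Log, Re, Im; cbn [fst snd]; intros Ha.
  assert (Hpos : (0 < a ^ 2 + b ^ 2)%R) by nra.
  assert (He : exp (ln (a ^ 2 + b ^ 2) / 2) = sqrt (a ^ 2 + b ^ 2)).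
  { apply Rsqr_inj; [left; apply exp_pos|apply sqrt_pos|].
    rewrite Rsqr_sqrt by lra; unfold Rsqr.
    rewrite <- exp_plus.
    replace (_ + _)%R with (ln (a ^ 2 + b ^ 2)) by field.
    apply exp_ln, Hpos. }
  assert (Hs : sqrt (1 + (b / a) ^ 2) = (sqrt (a ^ 2 + b ^ 2) / a)%R).
  { replace (1 + (b / a) ^ 2)%R with ((a ^ 2 + b ^ 2) / a ^ 2)%R by (field; lra).
    rewrite sqrt_div_alt by nra.
    rewrite (sqrt_pow2 a) by lra; reflexivity. }
  pose proof (sqrt_lt_R0 _ Hpos).
  rewrite He, cos_atan, sin_atan.
  unfold Rsqr; replace (b / a * (b / a))%R with ((b / a) ^ 2)%R by ring.
  rewrite Hs; f_equal; field; lra.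
Qed.

Lemma Log_Cexp (w : C) : (- (PI / 2) < Im w < PI / 2)%R -> Log (Cexp w) = w.
Proof.
  destruct w as [a b]; unfold Cexp, Log, Re, Im; cbn [fst snd]; intros Hb.
  pose proof (exp_pos a) as Ha.
  pose proof (cos_gt_0 b (proj1 Hb) (proj2 Hb)) as Hc.
  f_equal.
  - replace (_ + _)%R with (exp (a + a)).
    + rewrite ln_exp; field.
    + rewrite exp_plus; pose proof (sin2_cos2 b) as H; unfold Rsqr in H.
      transitivity (exp a * exp a * (sin b * sin b + cos b * cos b))%R; [|ring].
      rewrite H; ring.
  - replace (_ / _)%R with (tan b); [apply atan_tan, Hb|].
    unfold tan; field; split; lra.
Qed.

Lemma Re_pos_neq_0 (w : C) : (0 < Re w)%R -> w <> 0.
Proof. intros H ->; unfold Re in H; simpl in H; lra. Qed.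

Lemma is_cderive_Log (f : R -> C) (t : R) (a : C) :
  (0 < Re (f t))%R -> is_cderive f t a -> is_cderive (fun r => Log (f r)) t (a / f t).
Proof.
  intros Hp [H1 H2]; unfold Re, Im in *.
  assert (Hq : (0 < fst (f t) ^ 2 + snd (f t) ^ 2)%R) by nra.
  split; unfold Log; cbn [Re Im fst snd].
  - eapply is_derive_eq.
    + apply (is_derive_comp (fun y => ln y / 2)%R).
      * apply (is_derive_eq _ _ (/ (fst (f t) ^ 2 + snd (f t) ^ 2) / 2)%R); [|reflexivity].
        auto_derive; [exact Hq|field; simpl in *; lra].
      * exact (is_derive_plus _ _ _ _ _ (is_derive_pow _ 2 _ _ H1) (is_derive_pow _ 2 _ _ H2)).
    + unfold scal, plus, Re; simpl; unfold mult; simpl; field; simpl in *; lra.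
  - eapply is_derive_eq.
    + apply (is_derive_comp atan).
      * apply is_derive_Reals, derivable_pt_lim_atan.
      * apply is_derive_div; [exact H2|exact H1|lra].
    + unfold scal, plus, Im, Rsqr; simpl; unfold mult; simpl; field; simpl in *.
      repeat split; try lra; nra.
Qed.

Lemma continuous_Log {U : UniformSpace} (F : U -> C) (x : U) :
  (0 < Re (F x))%R -> continuous (U := C_UniformSpace) F x ->
  continuous (U := C_UniformSpace) (fun y => Log (F y)) x.
Proof.
  intros Hx HF; unfold Re in Hx.
  apply continuous_C; unfold Log; cbn [Re Im fst snd].
  - apply (continuous_real_comp (fun r => ln r / 2)%R); [|apply continuous_norm_sqr, HF].
    auto_derive; nra.
  - apply (continuous_real_comp atan).
    + eexists; apply is_derive_Reals, derivable_pt_lim_atan.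
    + apply (continuous_mult (K := R_AbsRing)); [apply continuous_Im, HF|].
      apply (continuous_real_comp Rinv); [|apply continuous_Re, HF].
      auto_derive; lra.
Qed.

Section LogAndExp.
Context {E : NormedModule R_AbsRing}.
(** A continuous real-linear map. The logarithm lemmas are applied to the two coordinates of [M_T],
    the exponential ones to [- phase n] on the plane covering [T]. *)
Context (m : E -> C)
  (m_linear : forall x v r, m (plus x (scal r v)) = m x + RtoC r * m v)
  (m_cont : forall x, continuous (U := C_UniformSpace) m x).

Lemma is_Dir_linear (x v : E) : is_Dir m x v (m v).
Proof.
  apply (is_cderive_ext (fun r => m x + RtoC r * m v)).
  - intros r; symmetry; apply m_linear.
  - apply is_cderive_affine.
Qed.

Lemma is_Dir_log (w c : C) (x v : E) :
  (0 < Re (c * m x))%R -> is_Dir (fun y => w + Log (c * m y)) x v (m v / m x).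
Proof.
  intros Hp.
  assert (Hcx : c * m x <> 0) by (apply Re_pos_neq_0, Hp).
  assert (Hc : c <> 0) by (intros ->; apply Hcx; ring).
  assert (Hx : m x <> 0) by (intros H; apply Hcx; rewrite H; ring).
  eapply is_cderive_eq.
  - apply is_cderive_plus; [apply is_cderive_const|].
    apply is_cderive_Log; [|apply is_cderive_scal, is_Dir_linear].
    cbv beta; rewrite line_0; exact Hp.
  - cbv beta; rewrite line_0; field; split; assumption.
Qed.

Lemma smooth_log (D : E -> Prop) (w c : C) :
  open D -> (forall x, D x -> (0 < Re (c * m x))%R) ->
  smooth D (fun x => w + Log (c * m x)).
Proof.
  intros HD Hp.
  assert (Hm : forall x, D x -> m x <> 0).
  { intros x Hx H; apply (Re_pos_neq_0 _ (Hp x Hx)); rewrite H; ring. }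
  (* The stable class consists of the logarithm itself and all multiples of powers of [1 / m]: one
     derivative of the logarithm gives [m v / m x], and each further one raises the power by 1. *)
  apply (smooth_of_stable_class D (fun F =>
    F = (fun x => w + Log (c * m x)) \/ exists a n, F = fun x => a * (/ m x) ^ n));
    [exact HD| |left; reflexivity].
  intros F [->|[a [n ->]]]; split.
  - intros x Hx; apply continuous_Cplus; [apply continuous_const|].
    apply continuous_Log; [apply Hp, Hx|].
    apply continuous_Cmult; [apply continuous_const|apply m_cont].
  - intros v; exists (fun x => m v * (/ m x) ^ 1); split.
    + right; exists (m v), 1%nat; reflexivity.
    + intros x Hx; rewrite Cpow_1_r; apply is_Dir_log, Hp, Hx.
  - intros x Hx; apply continuous_Cmult; [apply continuous_const|].
    apply continuous_Cpow, continuous_Cinv; [apply Hm, Hx|apply m_cont].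
  - intros v; exists (fun x => (- a * RtoC (INR n) * m v) * (/ m x) ^ S n); split.
    + right; eexists _, _; reflexivity.
    + intros x Hx; eapply is_cderive_eq.
      * apply is_cderive_scal, is_cderive_inv_pow; [|apply is_Dir_linear].
        cbv beta; rewrite line_0; apply Hm, Hx.
      * cbv beta; rewrite line_0; ring.
Qed.

Lemma is_Dir_exp (x v : E) : is_Dir (fun y => Cexp (m y)) x v (m v * Cexp (m x)).
Proof.
  eapply is_cderive_eq.
  - apply is_cderive_exp, is_Dir_linear.
  - cbv beta; rewrite line_0; reflexivity.
Qed.

Lemma smooth_exp : smooth (fun _ => True) (fun x => Cexp (m x)).
Proof.
  apply (smooth_of_stable_class _ (fun F => exists a, F = fun x => a * Cexp (m x))).
  - apply open_true.
  - intros F [a ->]; split.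
    + intros x _; apply continuous_Cmult; [apply continuous_const|].
      apply continuous_Cexp, m_cont.
    + intros v; exists (fun x => (a * m v) * Cexp (m x)); split; [eauto|].
      intros x _; eapply is_cderive_eq.
      * apply is_cderive_scal, is_Dir_exp.
      * ring.
  - exists 1; extensionality x; ring.
Qed.

End LogAndExp.

(** * Local sections and the connection form *)

Lemma Int_T_const (c : C) : Int_T (fun _ => c) = c.
Proof.
  unfold Int_T.
  rewrite !RInt_const, !scal_R_Cmult.
  replace (1 - 0)%R with 1%R by ring; ring.
Qed.

(** Dividing the coordinates of [mu] by those of [e w] moves the base point to [(1, 1)]. A logarithm
    on the right half-plane thus yields, near any [e w], the branch of the inverse of [e] that takes
    the value [w] there. *)
Definition log_domain (w mu : C * C) : Prop :=
  (0 < Re (Cexp (- fst w) * fst mu))%R /\ (0 < Re (Cexp (- snd w) * snd mu))%R.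

Definition log_branch (w mu : C * C) : C * C :=
  (fst w + Log (Cexp (- fst w) * fst mu), snd w + Log (Cexp (- snd w) * snd mu)).

Lemma continuous_fst_C2R (x : C2R) : continuous (U := C_UniformSpace) (fun y : C2R => fst y) x.
Proof. destruct x; apply (@continuous_fst C_UniformSpace C_UniformSpace). Qed.

Lemma continuous_snd_C2R (x : C2R) : continuous (U := C_UniformSpace) (fun y : C2R => snd y) x.
Proof. destruct x; apply (@continuous_snd C_UniformSpace C_UniformSpace). Qed.

Lemma fst_C2R_linear (x v : C2R) (r : R) :
  fst (plus x (scal r v)) = fst x + RtoC r * fst v.
Proof. rewrite <- scal_R_Cmult; reflexivity. Qed.

Lemma snd_C2R_linear (x v : C2R) (r : R) :
  snd (plus x (scal r v)) = snd x + RtoC r * snd v.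
Proof. rewrite <- scal_R_Cmult; reflexivity. Qed.

Lemma open_log_domain (w : C * C) : open (T := C2R) (log_domain w).
Proof.
  apply open_and.
  - apply (open_comp (T := C2R) (fun mu => Re (Cexp (- fst w) * fst mu)) (fun y => (0 < y)%R));
      [|apply open_gt].
    intros mu _; apply (continuous_Re (U := C2R)), continuous_Cmult;
      [apply continuous_const|apply continuous_fst_C2R].
  - apply (open_comp (T := C2R) (fun mu => Re (Cexp (- snd w) * snd mu)) (fun y => (0 < y)%R));
      [|apply open_gt].
    intros mu _; apply (continuous_Re (U := C2R)), continuous_Cmult;
      [apply continuous_const|apply continuous_snd_C2R].
Qed.

Lemma e_log_branch (w mu : C * C) : log_domain w mu -> e (log_branch w mu) = mu.
Proof.
  intros [H1 H2]; unfold e, log_branch; cbn [fst snd].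
  rewrite !Cexp_plus, !Cexp_Log, !Cexp_opp by assumption.
  apply injective_projections; cbn [fst snd]; field; apply Cexp_neq_0.
Qed.

Lemma log_domain_MT (w mu : C * C) : log_domain w mu -> MT mu.
Proof.
  intros H; rewrite <- (e_log_branch w mu H); split; apply Cexp_neq_0.
Qed.

(** Within a quarter turn of [w] the branch returns [p] itself and not a translate by periods. This
    is what lets a branch follow a curve in the cover for a short time. *)
Lemma log_domain_e (w p : C * C) :
  (- (PI / 2) < Im (fst p - fst w) < PI / 2)%R ->
  (- (PI / 2) < Im (snd p - snd w) < PI / 2)%R ->
  log_domain w (e p) /\ log_branch w (e p) = p.
Proof.
  intros H1 H2.
  assert (E1 : Cexp (- fst w) * Cexp (fst p) = Cexp (fst p - fst w))
    by (rewrite <- Cexp_plus; f_equal; ring).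
  assert (E2 : Cexp (- snd w) * Cexp (snd p) = Cexp (snd p - snd w))
    by (rewrite <- Cexp_plus; f_equal; ring).
  assert (Hre : forall z, (- (PI / 2) < Im z < PI / 2)%R -> (0 < Re (Cexp z))%R).
  { intros z [Hz1 Hz2]; apply Rmult_lt_0_compat; [apply exp_pos|apply cos_gt_0; assumption]. }
  unfold log_domain, log_branch, e; cbn [fst snd].
  rewrite E1, E2, !Log_Cexp by assumption.
  split; [split; apply Hre; assumption|].
  apply injective_projections; cbn [fst snd]; ring.
Qed.

Lemma log_branch_lift (w : C * C) :
  lift_over (log_domain w) (fun mu => hat_t0 (log_branch w mu)) (log_branch w) (fun _ => 1).
Proof.
  pose proof (open_log_domain w) as Ho.
  repeat split.
  - exact Ho.
  - apply e_log_branch.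
  - refine (smooth_log (E := C2R) (fun mu : C2R => fst mu) _ _ _ (fst w) _ Ho _).
    + apply fst_C2R_linear.
    + apply continuous_fst_C2R.
    + intros mu [H _]; exact H.
  - refine (smooth_log (E := C2R) (fun mu : C2R => snd mu) _ _ _ (snd w) _ Ho _).
    + apply snd_C2R_linear.
    + apply continuous_snd_C2R.
    + intros mu [_ H]; exact H.
  - apply (smooth_const (E := C2T)).
    apply (open_comp (T := C2T) (U := C2R) (fun x => fst x)); [|exact Ho].
    intros [x y] _; apply (@continuous_fst C2R R2).
  - intros; exact C1_nz.
Qed.

Lemma log_branch_section (w : C * C) :
  smooth_section (log_domain w) (fun mu => hat_t0 (log_branch w mu)).
Proof.
  split; [apply open_log_domain|split; [apply log_domain_MT|]].
  intros mu Hmu; exists (log_domain w), (log_branch w), (fun _ => 1).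
  auto using log_branch_lift.
Qed.

Lemma dlog_1 {E : NormedModule R_AbsRing} (x v : E) : dlog (fun _ => 1) x v = 0.
Proof.
  unfold dlog; rewrite (is_Dir_unique _ _ _ _ (is_Dir_const 1 x v)).
  field.
Qed.

(** With fibre coordinate 1, [t^* eta = - u dtheta^1 - v dtheta^2]. It vanishes on [X] and its
    coefficients do not depend on [theta], so [t^* eta /\ d (t^* eta)] evaluates on [X] and the two
    torus directions to the constant [v du(X) - u dv(X)], with [du = dmu_1 / mu_1] and
    [dv = dmu_2 / mu_2]. *)
Lemma conn_form_log_branch (w mu X : C * C) :
  log_domain w mu ->
  conn_form (log_branch w) (fun _ => 1) mu X =
  Ci / RtoC (4 * PI) *
  (snd (log_branch w mu) * (fst X / fst mu) - fst (log_branch w mu) * (snd X / snd mu)).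
Proof.
  intros [H1 H2].
  assert (D1 : is_Dir (E := C2R) (fun nu => fst (log_branch w nu)) mu X (fst X / fst mu)).
  { refine (is_Dir_log (E := C2R) (fun nu : C2R => fst nu) _ (fst w) _ mu X H1).
    apply fst_C2R_linear. }
  assert (D2 : is_Dir (E := C2R) (fun nu => snd (log_branch w nu)) mu X (snd X / snd mu)).
  { refine (is_Dir_log (E := C2R) (fun nu : C2R => snd nu) _ (snd w) _ mu X H2).
    apply snd_C2R_linear. }
  set (u := log_branch w) in *.
  assert (HA : eta_VT u (fun _ => 1) = fun x v =>
    - (fst (u (fst x)) * RtoC (fst (snd v)) + snd (u (fst x)) * RtoC (snd (snd v)))).
  { extensionality x; extensionality v.
    change (dlog (E := C2T) (fun _ => 1) x v
      - fst (u (fst x)) * RtoC (fst (snd v)) - snd (u (fst x)) * RtoC (snd (snd v))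
      = - (fst (u (fst x)) * RtoC (fst (snd v)) + snd (u (fst x)) * RtoC (snd (snd v)))).
    rewrite dlog_1; ring. }
  assert (HD : forall th (a b : R),
    Dir (E := C2T) (fun y => - (fst (u (fst y)) * RtoC a + snd (u (fst y)) * RtoC b))
      (mu, th) (X, (0%R, 0%R)) = - (fst X / fst mu * RtoC a + snd X / snd mu * RtoC b)).
  { intros th a b; apply is_Dir_unique.
    assert (H := is_cderive_opp _ _ _ (is_cderive_plus _ _ _ _ _
      (is_cderive_mult _ _ _ _ _ D1 (is_cderive_const (RtoC a) 0%R))
      (is_cderive_mult _ _ _ _ _ D2 (is_cderive_const (RtoC b) 0%R)))).
    apply (is_cderive_eq _ _ _ _ H).
    cbv beta; ring. }
  (* These are the terms of [d1] that differentiate [t^* eta] evaluated on [X], which is identically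
     0. *)
  assert (HD0 : forall th (v : C2T),
    Dir (E := C2T) (fun y => - (fst (u (fst y)) * RtoC 0 + snd (u (fst y)) * RtoC 0))
      (mu, th) v = 0).
  { intros th v; apply is_Dir_unique.
    apply (is_cderive_ext (fun _ => RtoC 0)); [intros r; ring|apply is_cderive_const]. }
  unfold conn_form; cbv zeta; f_equal.
  rewrite <- (Int_T_const (_ - _)); f_equal; extensionality th.
  rewrite HA; unfold wedge12, d1; cbn [fst snd].
  rewrite !HD, !HD0; ring.
Qed.

(** * Flat sections along curves *)

Lemma Cplus_eq_0_opp (z w : C) : z + w = 0 -> z = - w.
Proof.
  intros H.
  transitivity (z + w + - w); [ring|rewrite H; ring].
Qed.

Lemma is_derive_shift (f : R -> R) (a d : R) :
  is_derive (fun r => f (a + r)%R) 0%R d -> is_derive f a d.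
Proof.
  intros H.
  apply (is_derive_ext (fun s => f (a + (s - a))%R)); [intros s; f_equal; ring|].
  eapply is_derive_eq.
  - apply (is_derive_comp (fun r => f (a + r)%R) (fun s => s - a)%R a d 1%R).
    + replace (a - a)%R with 0%R by ring; exact H.
    + auto_derive; auto; ring.
  - unfold scal; simpl; unfold mult; simpl; ring.
Qed.

(** Total differentiability follows once one partial derivative exists nearby and is continuous at
    the point while the other exists at the point; the chain rule along [z] is then available. *)
Lemma is_derive_comp_plane (g d1 : C -> R) (z : R -> C) (t d2 a b : R) :
  locally (T := C_UniformSpace) (z t)
    (fun w => is_derive (fun r => g (fst w + r, snd w)%R) 0%R (d1 w)) ->
  is_derive (fun r => g (fst (z t), snd (z t) + r)%R) 0%R d2 ->
  continuous (T := C_UniformSpace) d1 (z t) ->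
  is_derive (fun r => fst (z r)) t a -> is_derive (fun r => snd (z r)) t b ->
  is_derive (fun r => g (z r)) t (d1 (z t) * a + d2 * b)%R.
Proof.
  intros H1 H2 Hc Ha Hb.
  apply (is_derive_ext (fun r => g (fst (z r), snd (z r)))).
  { intros r; rewrite <- surjective_pairing; reflexivity. }
  apply is_derive_Reals in Ha, Hb; apply is_derive_Reals.
  apply (derivable_pt_lim_comp_2d (fun x y => g (x, y)) (fun r => fst (z r))
    (fun r => snd (z r))); [|exact Ha|exact Hb].
  apply filterdiff_differentiable_pt_lim.
  assert (Hz : z t = (fst (z t), snd (z t))) by apply surjective_pairing.
  replace (d1 (z t)) with (d1 (fst (z t), snd (z t))) by (f_equal; symmetry; exact Hz).
  apply (is_derive_filterdiff (fun x y => g (x, y)) (fst (z t)) (snd (z t))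
    (fun x y => d1 (x, y)) d2).
  - rewrite <- Hz; revert H1; apply filter_imp; intros w Hw.
    rewrite <- surjective_pairing; apply is_derive_shift, Hw.
  - apply is_derive_shift, H2.
  - rewrite <- Hz; apply (continuous_ext d1); [|exact Hc].
    intros w; rewrite <- surjective_pairing; reflexivity.
Qed.

(** [smooth] speaks of straight lines only; continuity of the derivative in direction 1 extends this
    to curves. Smoothness is real, not holomorphic, so the directions 1 and [i] contribute
    separately. *)
Lemma is_cderive_comp_smooth (D : C -> Prop) (s : C -> C) (z : R -> C) (t : R) (z' : C) :
  open (T := C_R_NormedModule) D -> smooth (E := C_R_NormedModule) D s -> D (z t) ->
  is_cderive z t z' ->
  is_cderive (fun r => s (z r)) t
    (Dir (E := C_R_NormedModule) s (z t) (RtoC 1) * RtoC (Re z')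
     + Dir (E := C_R_NormedModule) s (z t) Ci * RtoC (Im z')).
Proof.
  intros HD Hs Hz [Hx Hy].
  destruct (Hs 1%nat) as [_ H].
  assert (H1 : forall w, D w -> is_cderive (fun r => s (fst w + r, snd w)%R) 0%R
    (Dir (E := C_R_NormedModule) s w (RtoC 1))).
  { intros w Hw.
    apply (is_cderive_ext (fun r => s (plus (G := C_R_NormedModule) w (scal r (RtoC 1))))).
    - intros r; f_equal; apply injective_projections; simpl;
        unfold plus, scal; simpl; unfold mult; simpl; ring.
    - apply (Dir_correct (E := C_R_NormedModule)), (proj1 (H (RtoC 1))), Hw. }
  assert (H2 : is_cderive (fun r => s (fst (z t), snd (z t) + r)%R) 0%R
    (Dir (E := C_R_NormedModule) s (z t) Ci)).
  { apply (is_cderive_ext (fun r => s (plus (G := C_R_NormedModule) (z t) (scal r Ci)))).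
    - intros r; f_equal; apply injective_projections; simpl;
        unfold plus, scal; simpl; unfold mult; simpl; ring.
    - apply (Dir_correct (E := C_R_NormedModule)), (proj1 (H Ci)), Hz. }
  assert (Hc := proj1 (proj2 (H (RtoC 1))) (z t) Hz).
  split.
  - eapply is_derive_eq.
    + apply (is_derive_comp_plane (fun w => Re (s w))
        (fun w => Re (Dir (E := C_R_NormedModule) s w (RtoC 1))) z t
        (Re (Dir (E := C_R_NormedModule) s (z t) Ci)) (Re z') (Im z'));
        [|apply H2| |exact Hx|exact Hy].
      * apply (filter_imp (F := locally (T := C_UniformSpace) (z t)) D);
          [intros w Hw; exact (proj1 (H1 w Hw))|exact (HD (z t) Hz)].
      * apply (continuous_Re (U := C_UniformSpace)), Hc.
    + unfold Re, Im; simpl; ring.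
  - eapply is_derive_eq.
    + apply (is_derive_comp_plane (fun w => Im (s w))
        (fun w => Im (Dir (E := C_R_NormedModule) s w (RtoC 1))) z t
        (Im (Dir (E := C_R_NormedModule) s (z t) Ci)) (Re z') (Im z'));
        [|apply H2| |exact Hx|exact Hy].
      * apply (filter_imp (F := locally (T := C_UniformSpace) (z t)) D);
          [intros w Hw; exact (proj2 (H1 w Hw))|exact (HD (z t) Hz)].
      * apply (continuous_Im (U := C_UniformSpace)), Hc.
    + unfold Re, Im; simpl; ring.
Qed.

Lemma is_cderive_locally_Im (u : R -> C) (t eps : R) (u' : C) :
  (0 < eps)%R -> is_cderive u t u' ->
  locally t (fun r => (- eps < Im (u r - u t) < eps)%R).
Proof.
  intros He [_ H].
  assert (Hc : continuous (fun r => Im (u r)) t)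
    by (apply (ex_derive_continuous (V := R_NormedModule)); eexists; exact H).
  assert (Hl : locally t (fun r => ball (Im (u t)) eps (Im (u r))))
    by exact (Hc _ (locally_ball (Im (u t)) (mkposreal eps He))).
  revert Hl; apply filter_imp; intros r Hr.
  apply Rabs_def2 in Hr; unfold minus, plus, opp, Im in *; simpl in *; lra.
Qed.

(** The quotient [(e')^* tau / hat tau_0'], since [hat tau_0'] has value 1 on [hat_t0]. *)
Definition hat_value (tau : C * C -> (R * R -> Q) -> C) (p : C * C) : C :=
  tau (e p) (hat_t0 p).

(** Near [t] the branch centred at [(u t, v t)] follows the curve, so [hat_value] along it is the
    coefficient [s] of [tau] for that branch, evaluated at [exp u]. The equation
    [ds = - s conn_form] and the value of the connection form give the derivative. *)
Lemma flat_along_curve (tau : C * C -> (R * R -> Q) -> C) (u v : R -> C) (t : R) (u' v' : C) :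
  flat_section tau -> (forall r, hatMT' (u r, v r)) ->
  is_cderive u t u' -> is_cderive v t v' ->
  is_cderive (fun r => hat_value tau (u r, v r)) t
    (Ci / RtoC (4 * PI) * (u t * v' - v t * u') * hat_value tau (u t, v t)).
Proof.
  intros [_ Hflat] Hp Hu Hv; unfold hatMT' in Hp; cbn [fst snd] in Hp.
  set (w := (u t, v t)).
  destruct (Hflat _ _ (log_branch_section w)) as [Hs HD]; cbv zeta in Hs, HD.
  set (s := fun z => tau (chart z) (hat_t0 (log_branch w (chart z)))) in *.
  specialize (HD _ _ _ (fun mu H => H) (log_branch_lift w)).
  assert (Hchart : forall r, chart (Cexp (u r)) = e (u r, v r)).
  { intros r; unfold chart, e; cbn [fst snd]; rewrite <- (Hp r); f_equal; ring. }
  pose proof PI_RGT_0 as Hpi.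
  assert (Hw : log_domain w (e w) /\ log_branch w (e w) = w).
  { apply log_domain_e.
    - replace (_ - _) with (RtoC 0) by ring; simpl; lra.
    - replace (_ - _) with (RtoC 0) by ring; simpl; lra. }
  destruct Hw as [Hw1 Hw2].
  assert (Hloc : locally t (fun r => s (Cexp (u r)) = hat_value tau (u r, v r))).
  { assert (Hpi2 : (0 < PI / 2)%R) by lra.
    generalize (filter_and _ _ (is_cderive_locally_Im u t _ u' Hpi2 Hu)
      (is_cderive_locally_Im v t _ v' Hpi2 Hv)).
    apply filter_imp; intros r [Hr1 Hr2].
    destruct (log_domain_e w (u r, v r) Hr1 Hr2) as [_ Hr].
    unfold s, hat_value; rewrite Hchart, Hr; reflexivity. }
  assert (HW : open (T := C_R_NormedModule) (fun z => log_domain w (chart z))).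
  { apply (open_comp (T := C_R_NormedModule) (U := C2R) chart);
      [|apply open_log_domain].
    intros z _; apply (continuous_comp_2 (V := C_UniformSpace) (W := C_UniformSpace)
      (X := prod_UniformSpace C_UniformSpace C_UniformSpace)
      (fun z => z) (fun z => 1 - z) (fun a b => (a, b))).
    - apply continuous_id.
    - apply continuous_Cplus; [apply continuous_const|].
      apply (continuous_opp (V := C_R_NormedModule)), continuous_id.
    - apply (continuous_ext (fun p : C * C => p)); [intros []; reflexivity|].
      apply continuous_id. }
  assert (Hz : is_cderive (fun r => Cexp (u r)) t (u' * Cexp (u t)))
    by (apply is_cderive_exp, Hu).
  assert (HWt : log_domain w (chart (Cexp (u t)))) by (rewrite Hchart; exact Hw1).
  apply (is_cderive_ext_loc (fun r => s (Cexp (u r)))); [exact Hloc|].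
  eapply is_cderive_eq.
  { exact (is_cderive_comp_smooth _ s _ t _ HW Hs HWt Hz). }
  assert (Hst : s (Cexp (u t)) = hat_value tau w) by exact (locally_singleton _ _ Hloc).
  rewrite <- Hst.
  assert (HDir : forall xi, Dir (E := C_R_NormedModule) s (Cexp (u t)) xi =
    - (Ci / RtoC (4 * PI)) * (v t * (xi / Cexp (u t)) + u t * (xi / Cexp (v t)))
    * s (Cexp (u t))).
  { intros xi.
    assert (H := HD (Cexp (u t)) xi HWt).
    rewrite conn_form_log_branch in H by exact HWt.
    rewrite Hchart in H; change (u t, v t) with w in H; rewrite Hw2 in H.
    unfold w, dchart, e in H; cbn [fst snd] in H.
    apply Cplus_eq_0_opp in H; rewrite H, Hst.
    unfold hat_value, w, e; cbn [fst snd].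
    field; repeat split; try apply Cexp_neq_0.
    intros H0; apply RtoC_inj in H0; lra. }
  (* Differentiating [exp u + exp v = 1]; this turns the second coordinate of the tangent vector
     into a multiple of [v']. *)
  assert (Huv : u' * Cexp (u t) = - (v' * Cexp (v t))).
  { assert (H := is_cderive_unique _ _ _ _ (is_cderive_plus _ _ _ _ _ Hz (is_cderive_exp _ _ _ Hv))
      (is_cderive_ext _ _ _ _ (fun r => eq_sym (Hp r)) (is_cderive_const 1 t))).
    apply Cplus_eq_0_opp, H. }
  rewrite !HDir.
  transitivity (- (Ci / RtoC (4 * PI)) * (v t / Cexp (u t) + u t / Cexp (v t))
    * (RtoC (Re (u' * Cexp (u t))) + Ci * RtoC (Im (u' * Cexp (u t)))) * s (Cexp (u t))).
  { unfold Cdiv; ring. }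
  (* The connection form is complex linear in the tangent vector, so the contributions of the
     directions 1 and [i] recombine into the full derivative of [exp u]. *)
  assert (Hri : forall c : C, RtoC (Re c) + Ci * RtoC (Im c) = c).
  { intros c; apply injective_projections; unfold Re, Im; simpl; ring. }
  rewrite Hri.
  replace (- (Ci / RtoC (4 * PI)) * (v t / Cexp (u t) + u t / Cexp (v t)) * (u' * Cexp (u t)))
    with (- (Ci / RtoC (4 * PI)) *
      (v t / Cexp (u t) * (u' * Cexp (u t)) + u t / Cexp (v t) * (u' * Cexp (u t)))) by ring.
  rewrite Huv at 2.
  field; repeat split; try apply Cexp_neq_0.
  intros H0; apply RtoC_inj in H0; lra.
Qed.

(** * Deck transformations *)

Lemma Cexp_period (k : Z) : Cexp (two_pi_i * RtoC (IZR k)) = 1.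
Proof. apply Cexp_eq_1; exists k; reflexivity. Qed.

Lemma act_act (n m n' m' : Z * Z) (q : hatQ) :
  act n m (act n' m' q) =
  act (fst n + fst n', snd n + snd n')%Z (fst m + fst m', snd m + snd m')%Z q.
Proof.
  destruct q as [[[u1 u2] [th1 th2]] lam], n as [n1 n2], m as [m1 m2],
    n' as [n1' n2'], m' as [m1' m2'].
  unfold act, translate; cbn [fst snd].
  rewrite !plus_IZR, !RtoC_plus.
  apply injective_projections; [apply injective_projections; cbn [fst snd]; f_equal; ring|cbn [snd]].
  rewrite Cmult_assoc, <- Cexp_plus; f_equal.
  (* Moving [theta] by [m'] before acting by [n] changes the phase by
     [2 pi i (n_1 m_1' + n_2 m_2')], whose exponential is 1; hence the two actions commute. *)
  etransitivity; [|exact (Cmult_1_r _)].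
  rewrite <- (Cexp_period (n1 * m1' + n2 * m2')), <- Cexp_plus; f_equal.
  rewrite plus_IZR, !mult_IZR.
  repeat rewrite ?RtoC_plus, ?RtoC_mult; ring.
Qed.

Lemma orbit_act (n m : Z * Z) (q : hatQ) : orbit (act n m q) = orbit q.
Proof.
  extensionality q'; apply propositional_extensionality; split.
  - intros [n' [m' ->]]; rewrite act_act; eexists _, _; reflexivity.
  - intros [n' [m' ->]].
    exists (fst n' - fst n, snd n' - snd n)%Z, (fst m' - fst m, snd m' - snd m)%Z.
    rewrite act_act; cbn [fst snd].
    rewrite !Z.sub_add, <- !surjective_pairing; reflexivity.
Qed.

Definition deck (n : Z * Z) (p : C * C) : C * C :=
  (fst p + two_pi_i * RtoC (IZR (fst n)), snd p + two_pi_i * RtoC (IZR (snd n))).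

Definition phase (n : Z * Z) (th : R * R) : C :=
  two_pi_i * RtoC (IZR (fst n) * fst th + IZR (snd n) * snd th).

Lemma e_deck (n : Z * Z) (p : C * C) : e (deck n p) = e p.
Proof.
  unfold e, deck; cbn [fst snd].
  rewrite !Cexp_plus, !Cexp_period, !Cmult_1_r; reflexivity.
Qed.

(** The action by [n] sends [(p, theta, exp (- phase))] to the translate of [p] with fibre
    coordinate 1, and both represent the same point of [Q]. The factor 1 is kept to match the
    product [g * h] in [fiberL]. *)
Lemma hat_t0_deck (n : Z * Z) (p : C * C) :
  hat_t0 (deck n p) = sec p (fun th => 1 * Cexp (- phase n th)).
Proof.
  unfold hat_t0, sec; extensionality th.
  etransitivity; [|exact (orbit_act n (0, 0)%Z _)]; f_equal.
  unfold act, deck, translate, phase; destruct th as [th1 th2], p as [u1 u2]; cbn [fst snd].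
  apply injective_projections; [apply injective_projections; cbn [fst snd]; f_equal; ring|].
  cbn [snd].
  rewrite Cmult_1_l, Cexp_opp.
  field; apply Cexp_neq_0.
Qed.

Lemma opp_phase_linear (n : Z * Z) (x v : R2) (r : R) :
  - phase n (plus x (scal r v)) = - phase n x + RtoC r * - phase n v.
Proof.
  unfold phase.
  assert (H : (IZR (fst n) * fst (plus x (scal r v)) + IZR (snd n) * snd (plus x (scal r v))
    = (IZR (fst n) * fst x + IZR (snd n) * snd x)
      + r * (IZR (fst n) * fst v + IZR (snd n) * snd v))%R).
  { unfold plus, scal; simpl; unfold plus, scal; simpl; unfold mult; simpl; ring. }
  apply (f_equal RtoC) in H; rewrite (RtoC_plus (_ + _) (r * _)), (RtoC_mult r) in H.
  etransitivity; [exact (f_equal (fun z => - (two_pi_i * z)) H)|cbv beta; set (a := RtoC (_ + _)); set (b := RtoC (_ + _)); ring].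
Qed.

Lemma continuous_opp_phase (n : Z * Z) (x : R2) :
  continuous (U := C_UniformSpace) (fun th : R2 => - phase n th) x.
Proof.
  apply (continuous_opp (V := C_R_NormedModule)).
  apply continuous_Cmult; [apply continuous_const|].
  apply continuous_C; unfold RtoC, Re, Im; cbn [fst snd]; [|apply continuous_const].
  apply (continuous_plus (V := R_NormedModule));
    apply (continuous_mult (K := R_AbsRing)); try apply continuous_const; destruct x.
  - apply (@continuous_fst R_UniformSpace R_UniformSpace).
  - apply (@continuous_snd R_UniformSpace R_UniformSpace).
Qed.

Lemma dlog_phase (n : Z * Z) (x v : R2) :
  dlog (E := R2) (fun th => Cexp (- phase n th)) x v = - phase n v.
Proof.
  unfold dlog.
  rewrite (is_Dir_unique _ _ _ _ (is_Dir_exp (E := R2) _ (opp_phase_linear n) x v)).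
  field; apply Cexp_neq_0.
Qed.

Lemma smooth_phase (n : Z * Z) : smooth_T_Cstar (fun th => Cexp (- phase n th)).
Proof.
  split; [|split].
  - exact (smooth_exp (E := R2) _ (opp_phase_linear n) (continuous_opp_phase n)).
  - intros m th.
    rewrite !Cexp_opp; f_equal.
    transitivity (Cexp (phase n th) * Cexp (two_pi_i * RtoC (IZR (fst n * fst m + snd n * snd m)))).
    + rewrite <- Cexp_plus; f_equal.
      unfold phase, translate; cbn [fst snd].
      rewrite plus_IZR, !mult_IZR; repeat rewrite ?RtoC_plus, ?RtoC_mult; ring.
    + rewrite Cexp_period; ring.
  - intros th; apply Cexp_neq_0.
Qed.

Lemma winding_phase (n : Z * Z) :
  winding (fun th => Cexp (- phase n th)) (- fst n, - snd n)%Z.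
Proof.
  split; erewrite RInt_ext by (intros; apply dlog_phase);
    rewrite RInt_const; unfold phase; cbn [fst snd];
    rewrite scal_R_Cmult, opp_IZR, Rmult_1_r, Rmult_0_r, ?Rplus_0_r, ?Rplus_0_l,
      RtoC_opp, Rminus_0_r;
    match goal with |- ?a = ?b => change (@eq C a b) end; ring.
Qed.

Lemma smooth_T_Cstar_1 : smooth_T_Cstar (fun _ => 1).
Proof.
  split; [|split].
  - apply (smooth_const (E := R2)), open_true.
  - intros m th; reflexivity.
  - intros th; exact C1_nz.
Qed.

(** The fibre condition for [g = 1] and [h = exp (- phase n)]. Here [eta /\ dh / h] is the constant
    [2 pi i (u n_2 - v n_1)] times the area form, and the factor [- i / (4 pi)] turns it into half
    the bracket. The winding of [h] is [- n], with the same sign as [n]. *)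
Lemma hat_value_deck (tau : C * C -> (R * R -> Q) -> C) (n : Z * Z) (p : C * C) :
  flat_section tau -> hatMT' p ->
  hat_value tau (deck n p) =
  sign_sigma n * Cexp ((fst p * RtoC (IZR (snd n)) - snd p * RtoC (IZR (fst n))) / 2)
  * hat_value tau p.
Proof.
  intros [Hfib _] Hp.
  assert (Hmu : MT' (e p)).
  { split; [split; apply Cexp_neq_0|exact Hp]. }
  unfold hat_value; rewrite e_deck, hat_t0_deck.
  rewrite (Hfib _ Hmu p (fun _ => 1) (fun th => Cexp (- phase n th)) (- fst n, - snd n)%Z
    eq_refl smooth_T_Cstar_1 (smooth_phase n) (winding_phase n)).
  f_equal; f_equal.
  - unfold sign_sigma; cbn [fst snd].
    replace (- fst n * - snd n)%Z with (fst n * snd n)%Z by ring; reflexivity.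
  - f_equal.
    transitivity (- (Ci / RtoC (4 * PI)) *
      Int_T (fun _ => two_pi_i *
        (fst p * RtoC (IZR (snd n)) - snd p * RtoC (IZR (fst n))))).
    + f_equal; f_equal; extensionality th.
      unfold wedge11; rewrite !dlog_phase.
      change (eta_T p (fun _ => 1)) with (fun x v : R2 =>
        dlog (E := R2) (fun _ => 1) x v - fst p * RtoC (fst v) - snd p * RtoC (snd v)).
      cbv beta; rewrite !dlog_1; unfold phase; cbn [fst snd].
      rewrite !Rmult_1_r, !Rmult_0_r, ?Rplus_0_r, ?Rplus_0_l; ring.
    + rewrite Int_T_const; unfold two_pi_i.
      pose proof PI_RGT_0 as Hpi.
      assert (Hpi0 : RtoC PI <> 0) by (intros H; apply RtoC_inj in H; lra).
      rewrite !RtoC_mult.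
      transitivity (- (Ci * Ci) *
        ((fst p * RtoC (IZR (snd n)) - snd p * RtoC (IZR (fst n))) / 2)).
      * replace (RtoC 4) with (2 * 2) by (rewrite <- RtoC_mult; f_equal; ring).
        field; exact Hpi0.
      * replace (Ci * Ci) with (RtoC (-1)) by (apply injective_projections; simpl; ring).
        ring.
Qed.

(** * Primitives and logarithms along curves *)

Lemma is_cderive_continuous (f : R -> C) (t : R) (d : C) :
  is_cderive f t d -> continuous (U := C_UniformSpace) f t.
Proof.
  intros [H1 H2]; apply continuous_C;
    apply (ex_derive_continuous (V := R_NormedModule)); eexists; eassumption.
Qed.

Lemma exists_primitive (g : R -> C) :
  (forall t, continuous (U := C_UniformSpace) g t) ->
  exists G : R -> C, G 0%R = 0 /\ forall t, is_cderive G t (g t).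
Proof.
  intros Hg.
  exists (fun t => ((RInt (fun r => Re (g r)) 0%R t : R),
                    (RInt (fun r => Im (g r)) 0%R t : R)) : C).
  split; [rewrite !RInt_point; reflexivity|].
  intros t; split; cbn [Re Im fst snd].
  - apply (is_derive_RInt (fun r => Re (g r)) _ 0%R).
    + apply filter_forall; intros b; apply (RInt_correct (V := R_CompleteNormedModule)).
      apply (ex_RInt_continuous (V := R_CompleteNormedModule)); intros; apply continuous_Re, Hg.
    + apply continuous_Re, Hg.
  - apply (is_derive_RInt (fun r => Im (g r)) _ 0%R).
    + apply filter_forall; intros b; apply (RInt_correct (V := R_CompleteNormedModule)).
      apply (ex_RInt_continuous (V := R_CompleteNormedModule)); intros; apply continuous_Im, Hg.
    + apply continuous_Im, Hg.
Qed.

(** Take [u = w +] the integral of [f' / f] from 0; then [exp (- u) f] has zero derivative and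
    equals 1 at 0. Unlike [Log], this follows [f] around the origin. *)
Lemma exists_log_curve (f f' : R -> C) (w : C) :
  (forall t, is_cderive f t (f' t)) ->
  (forall t, continuous (U := C_UniformSpace) f' t) ->
  (forall t, f t <> 0) -> Cexp w = f 0%R ->
  exists u, u 0%R = w /\ forall t, Cexp (u t) = f t /\ exists d, is_cderive u t d.
Proof.
  intros Hf Hf' Hnz Hw.
  destruct (exists_primitive (fun t => f' t * / f t)) as [G [HG0 HG]].
  { intros t; apply continuous_Cmult; [apply Hf'|].
    apply continuous_Cinv; [apply Hnz|eapply is_cderive_continuous, Hf]. }
  assert (Hu : forall t, is_cderive (fun r => w + G r) t (0 + f' t * / f t)).
  { intros t; apply is_cderive_plus; [apply is_cderive_const|apply HG]. }
  exists (fun t => w + G t); split; [rewrite HG0; ring|].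
  intros t; split; [|eexists; apply Hu].
  assert (Hc : Cexp (- (w + G t)) * f t = Cexp (- (w + G 0%R)) * f 0%R).
  { apply (is_cderive_0_const (fun r => Cexp (- (w + G r)) * f r)).
    intros r.
    apply (is_cderive_eq _ _ _ _ (is_cderive_mult _ _ _ _ _
      (is_cderive_exp _ _ _ (is_cderive_opp _ _ _ (Hu r))) (Hf r))).
    field; apply Hnz. }
  rewrite HG0, Cplus_0_r, <- Hw, Cexp_opp_l in Hc.
  transitivity (Cexp (w + G t) * (Cexp (- (w + G t)) * f t)).
  - rewrite Hc; ring.
  - rewrite Cexp_opp; field; apply Cexp_neq_0.
Qed.

(** * Paths avoiding complex lines *)

(** The parabola [y = 4 c x (1 - x)] over [[0, 1]], from 0 at [s = 0] to 1 at [s = PI]. The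
    trigonometric parametrization runs it back and forth, so the curve is smooth on all of [R] and
    never leaves the arc. *)
Definition arc (c s : R) : C := ((1 - cos s) / 2, c * (sin s * sin s))%R.

Definition arc' (c s : R) : C := (sin s / 2, 2 * c * sin s * cos s)%R.

Lemma is_cderive_arc (c s : R) : is_cderive (arc c) s (arc' c s).
Proof.
  split; unfold arc, arc', Re, Im; cbn [fst snd]; auto_derive; auto; field.
Qed.

Lemma continuous_arc' (c s : R) : continuous (U := C_UniformSpace) (arc' c) s.
Proof.
  apply continuous_C; unfold arc', Re, Im; cbn [fst snd];
    apply (ex_derive_continuous (V := R_NormedModule)); auto_derive; exact I.
Qed.

(* The arcs with distinct [c] meet only at the endpoints 0 and 1. *)
Lemma arc_avoids_root (a b : C) :
  a <> 0 -> a + b <> 0 ->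
  exists M : R, forall c, (M < c)%R -> forall s, a + arc c s * b <> 0.
Proof.
  intros Ha Hab.
  (* If some arc [c0] passes through the root, that [c0] is the bound: a later arc through the same
     root would meet it away from the endpoints, where the two hypotheses exclude a root. *)
  destruct (classic (exists c0 s0, a + arc c0 s0 * b = 0)) as [[c0 [s0 H0]]|Hno];
    [|exists 0%R; intros c _ s H; apply Hno; eauto].
  exists c0; intros c Hc s H.
  assert (Hb : b <> 0).
  { intros ->; apply Ha; rewrite <- H; ring. }
  assert (Harc : arc c s = arc c0 s0).
  { transitivity ((a + arc c s * b - a) / b); [field; exact Hb|].
    rewrite H, <- H0; field; exact Hb. }
  unfold arc in Harc; injection Harc as H1 H2.
  pose proof (sin2_cos2 s) as S; pose proof (sin2_cos2 s0) as S0; unfold Rsqr in S, S0.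
  assert (Hcos : cos s = cos s0) by lra.
  rewrite Hcos in S.
  replace (sin s * sin s)%R with (sin s0 * sin s0)%R in H2 by lra.
  assert (Hsin : (sin s0 * sin s0 = 0)%R).
  { apply (Rmult_eq_reg_l (c - c0)); lra. }
  assert (Hcos0 : ((cos s0 - 1) * (cos s0 + 1) = 0)%R) by nra.
  apply Rmult_integral in Hcos0 as [E|E].
  - apply Ha; rewrite <- H0.
    replace (arc c0 s0) with (RtoC 0); [ring|].
    unfold arc; rewrite Hsin; apply injective_projections; simpl; lra.
  - apply Hab; rewrite <- H0.
    replace (arc c0 s0) with (RtoC 1); [ring|].
    unfold arc; rewrite Hsin; apply injective_projections; simpl; lra.
Qed.

Lemma arc_avoids_roots (l : list (C * C)) :
  (forall ab, List.In ab l -> fst ab <> 0 /\ fst ab + snd ab <> 0) ->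
  exists M : R, forall c, (M < c)%R ->
    forall ab, List.In ab l -> forall s, fst ab + arc c s * snd ab <> 0.
Proof.
  induction l as [|ab l IH]; intros Hl.
  - exists 0%R; intros c _ ab [].
  - destruct IH as [M1 H1]; [intros; apply Hl; right; assumption|].
    destruct (Hl ab (or_introl eq_refl)) as [Ha Hab].
    destruct (arc_avoids_root _ _ Ha Hab) as [M2 H2].
    exists (Rmax M1 M2); intros c Hc ab' [<-|Hin].
    + apply H2; pose proof (Rmax_r M1 M2); lra.
    + apply H1; [pose proof (Rmax_l M1 M2); lra|exact Hin].
Qed.

(** * The five-term relation *)

(** The relation for [v_j] is built in, so a configuration is given by the five numbers [u_j]
    alone. *)
Definition pt (u : nat -> C) (j : nat) : C * C :=
  (u j, u ((j + 4) mod 5)%nat + u ((j + 1) mod 5)%nat).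

Definition pentagon (u : nat -> C) : Prop := forall j, (j < 5)%nat -> hatMT' (pt u j).

Definition prod5 (f : nat -> C) : C := f 0%nat * f 1%nat * f 2%nat * f 3%nat * f 4%nat.

Definition five_value (tau : C * C -> (R * R -> Q) -> C) (u : nat -> C) : C :=
  prod5 (fun j => hat_value tau (pt u j)).

Lemma five_value_curve (tau : C * C -> (R * R -> Q) -> C) (U : R -> nat -> C) (a b : R) :
  flat_section tau -> (forall t, pentagon (U t)) ->
  (forall j, (j < 5)%nat -> forall t, exists d, is_cderive (fun r => U r j) t d) ->
  five_value tau (U a) = five_value tau (U b).
Proof.
  intros Hflat HU Hd.
  apply (is_cderive_0_const (fun t => five_value tau (U t))); intros t.
  assert (Hd' : exists d : nat -> C, forall j, (j < 5)%nat -> is_cderive (fun r => U r j) t (d j)).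
  { destruct (Hd 0%nat ltac:(lia) t) as [d0 H0], (Hd 1%nat ltac:(lia) t) as [d1 H1],
      (Hd 2%nat ltac:(lia) t) as [d2 H2], (Hd 3%nat ltac:(lia) t) as [d3 H3],
      (Hd 4%nat ltac:(lia) t) as [d4 H4].
    exists (fun j => match j with 0 => d0 | 1 => d1 | 2 => d2 | 3 => d3 | _ => d4 end%nat).
    intros j Hj; do 5 (destruct j as [|j]; [assumption|]); lia. }
  destruct Hd' as [d Hd'].
  assert (Hs : forall j, (j < 5)%nat ->
    is_cderive (fun r => hat_value tau (pt (U r) j)) t
      (Ci / RtoC (4 * PI) *
        (U t j * (d ((j + 4) mod 5)%nat + d ((j + 1) mod 5)%nat)
         - (U t ((j + 4) mod 5)%nat + U t ((j + 1) mod 5)%nat) * d j)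
       * hat_value tau (pt (U t) j))).
  { intros j Hj.
    assert (Hm : forall k, (k mod 5 < 5)%nat) by (intros k; apply Nat.mod_upper_bound; lia).
    apply (flat_along_curve tau (fun r => U r j)
      (fun r => U r ((j + 4) mod 5)%nat + U r ((j + 1) mod 5)%nat)); auto.
    - intros r; apply HU, Hj.
    - apply is_cderive_plus; apply Hd', Hm. }
  apply (is_cderive_eq _ _ _ _ (is_cderive_mult _ _ _ _ _ (is_cderive_mult _ _ _ _ _
    (is_cderive_mult _ _ _ _ _ (is_cderive_mult _ _ _ _ _
      (Hs 0%nat ltac:(lia)) (Hs 1%nat ltac:(lia))) (Hs 2%nat ltac:(lia)))
    (Hs 3%nat ltac:(lia))) (Hs 4%nat ltac:(lia)))).
  cbn -[RtoC hat_value pt Cmult Cplus Cdiv].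
  ring.
Qed.

Lemma five_value_deck (tau : C * C -> (R * R -> Q) -> C) (n : nat -> Z) (u : nat -> C) :
  flat_section tau -> pentagon u ->
  five_value tau (fun j => u j + two_pi_i * RtoC (IZR (n j))) = five_value tau u.
Proof.
  intros Hflat Hu.
  assert (Hj : forall j, (j < 5)%nat ->
    hat_value tau (pt (fun j => u j + two_pi_i * RtoC (IZR (n j))) j) =
    sign_sigma (n j, n ((j + 4) mod 5)%nat + n ((j + 1) mod 5)%nat)%Z *
    Cexp ((u j * (RtoC (IZR (n ((j + 4) mod 5)%nat)) + RtoC (IZR (n ((j + 1) mod 5)%nat)))
           - (u ((j + 4) mod 5)%nat + u ((j + 1) mod 5)%nat) * RtoC (IZR (n j))) / 2)
    * hat_value tau (pt u j)).
  { intros j Hj.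
    rewrite <- RtoC_plus, <- plus_IZR.
    etransitivity; [|exact (hat_value_deck tau
      (n j, n ((j + 4) mod 5)%nat + n ((j + 1) mod 5)%nat)%Z (pt u j) Hflat (Hu j Hj))].
    f_equal; unfold deck, pt; cbn [fst snd]; f_equal.
    rewrite plus_IZR, RtoC_plus; ring. }
  unfold five_value, prod5; rewrite !Hj by lia.
  cbn -[RtoC hat_value pt Cmult Cplus Cdiv Cminus Cexp Z.add Z.mul Z.even sign_sigma].
  match goal with |- (?s0 * Cexp ?z0 * ?f0) * (?s1 * Cexp ?z1 * ?f1) * (?s2 * Cexp ?z2 * ?f2)
      * (?s3 * Cexp ?z3 * ?f3) * (?s4 * Cexp ?z4 * ?f4) = _ =>
    assert (Hz : Cexp z0 * Cexp z1 * Cexp z2 * Cexp z3 * Cexp z4 = 1);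
    [rewrite <- !Cexp_plus, <- Cexp_0; f_equal; field; intros H; apply RtoC_inj in H; lra|];
    assert (Hs : s0 * s1 * s2 * s3 * s4 = 1);
    [|transitivity ((s0 * s1 * s2 * s3 * s4)
        * (Cexp z0 * Cexp z1 * Cexp z2 * Cexp z3 * Cexp z4) * (f0 * f1 * f2 * f3 * f4));
      [ring|rewrite Hz, Hs; ring]]
  end.
  (* The signs depend only on the parities of the five integers, which leaves 32 cases. *)
  unfold sign_sigma; cbn [fst snd].
  rewrite !Z.even_mul, !Z.even_add.
  destruct (Z.even (n 0%nat)), (Z.even (n 1%nat)), (Z.even (n 2%nat)), (Z.even (n 3%nat)),
    (Z.even (n 4%nat)); cbn [orb Bool.eqb]; ring.
Qed.

(** Writing [x_j = exp u_j], these identities express [x_4], [x_2] and [x_3] through the coordinates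
    [x_0], [x_1], and show that the units used along the arc have logarithms linear in the [u_j]. *)
Lemma pentagon_exp (u : nat -> C) :
  pentagon u ->
  1 - Cexp (u 0%nat) = Cexp (u 4%nat + u 1%nat) /\
  1 - Cexp (u 1%nat) = Cexp (u 0%nat + u 2%nat) /\
  Cexp (u 0%nat) + Cexp (u 1%nat) - 1 = Cexp (u 0%nat + u 1%nat + u 3%nat).
Proof.
  intros H.
  assert (H0 := H 0%nat ltac:(lia)); assert (H1 := H 1%nat ltac:(lia));
    assert (H2 := H 2%nat ltac:(lia)).
  unfold hatMT', pt in H0, H1, H2; cbn [fst snd] in H0, H1, H2.
  change (Cexp (u 0%nat) + Cexp (u 4%nat + u 1%nat) = 1) in H0.
  change (Cexp (u 1%nat) + Cexp (u 0%nat + u 2%nat) = 1) in H1.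
  change (Cexp (u 2%nat) + Cexp (u 1%nat + u 3%nat) = 1) in H2.
  rewrite !Cexp_plus in *.
  split; [|split].
  - rewrite <- H0; ring.
  - rewrite <- H1; ring.
  (* Multiply the relation at index 2 by [x_0], then use [x_0 x_2 = 1 - x_1]. *)
  - transitivity (Cexp (u 0%nat) * (Cexp (u 2%nat) + Cexp (u 1%nat) * Cexp (u 3%nat))
      + Cexp (u 1%nat) - 1); [rewrite H2; ring|].
    rewrite <- H1; ring.
Qed.

Lemma exists_log_line (a b w : C) (c : R) :
  (forall s, a + arc c s * b <> 0) -> Cexp w = a ->
  exists u, u 0%R = w /\
    (forall t, Cexp (u t) = a + arc c t * b) /\ forall t, exists d, is_cderive u t d.
Proof.
  intros Hnz Hw.
  destruct (exists_log_curve (fun s => a + arc c s * b) (fun s => arc' c s * b) w)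
    as [u [Hu0 Hu]]; try assumption.
  - intros t.
    apply (is_cderive_eq _ _ _ _ (is_cderive_plus _ _ _ _ _ (is_cderive_const a t)
      (is_cderive_mult _ _ _ _ _ (is_cderive_arc c t) (is_cderive_const b t)))).
    cbv beta; ring.
  - intros t; apply continuous_Cmult; [apply continuous_arc'|apply continuous_const].
  - rewrite Hw; replace (arc c 0) with (RtoC 0); [ring|].
    unfold arc; rewrite cos_0, sin_0; apply injective_projections; simpl; field.
  - exists u; split; [exact Hu0|split; intros t; apply (Hu t)].
Qed.

Lemma arc_PI (c : R) : arc c PI = 1.
Proof.
  unfold arc; rewrite cos_PI, sin_PI; apply injective_projections; simpl; field.
Qed.

(* The units [x_0], [x_1], [1 - x_0], [1 - x_1], [x_0 + x_1 - 1] of the five-term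
   variety restrict to affine functions of [arc], so each has a logarithm along it. *)
Lemma pentagon_curve (p q : nat -> C) :
  pentagon p -> pentagon q ->
  exists U : R -> nat -> C, U 0%R = p /\ (forall t, pentagon (U t)) /\
    (forall j, (j < 5)%nat -> forall t, exists d, is_cderive (fun r => U r j) t d) /\
    forall j, (j < 5)%nat -> Cexp (U PI j) = Cexp (q j).
Proof.
  intros Hp Hq.
  destruct (pentagon_exp p Hp) as [Hp0 [Hp1 Hp3]].
  destruct (pentagon_exp q Hq) as [Hq0 [Hq1 Hq3]].
  set (x0 := Cexp (p 0%nat)) in *; set (x1 := Cexp (p 1%nat)) in *.
  set (y0 := Cexp (q 0%nat)) in *; set (y1 := Cexp (q 1%nat)) in *.
  (* Each pair is the value of a unit at [p] and its increment to [q]; both end values are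
     exponentials, hence nonzero. *)
  destruct (arc_avoids_roots
    ((x0, y0 - x0) :: (x1, y1 - x1) :: (1 - x0, x0 - y0) :: (1 - x1, x1 - y1)
     :: (x0 + x1 - 1, y0 + y1 - x0 - x1) :: nil)%list) as [M HM].
  { intros ab Hab.
    cbn [List.In] in Hab.
    destruct Hab as [<-|[<-|[<-|[<-|[<-|[]]]]]]; cbn [fst snd]; split.
    - apply Cexp_neq_0.
    - replace (_ + _) with y0 by ring; apply Cexp_neq_0.
    - apply Cexp_neq_0.
    - replace (_ + _) with y1 by ring; apply Cexp_neq_0.
    - rewrite Hp0; apply Cexp_neq_0.
    - replace (_ + _) with (1 - y0) by ring; rewrite Hq0; apply Cexp_neq_0.
    - rewrite Hp1; apply Cexp_neq_0.
    - replace (_ + _) with (1 - y1) by ring; rewrite Hq1; apply Cexp_neq_0.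
    - rewrite Hp3; apply Cexp_neq_0.
    - replace (_ + _) with (y0 + y1 - 1) by ring; rewrite Hq3; apply Cexp_neq_0. }
  assert (Hc : (M < M + 1)%R) by lra.
  specialize (HM _ Hc); set (c := (M + 1)%R) in *.
  destruct (exists_log_line x0 (y0 - x0) (p 0%nat) c) as [a0 [Ia0 [Ea0 Da0]]];
    [apply (HM (_, _)); cbn [List.In]; tauto|reflexivity|].
  destruct (exists_log_line x1 (y1 - x1) (p 1%nat) c) as [a1 [Ia1 [Ea1 Da1]]];
    [apply (HM (_, _)); cbn [List.In]; tauto|reflexivity|].
  (* The logarithm starts at the sum [p_4 + p_1] prescribed by the relation, so that subtracting
     [a1] later gives [p_4] exactly at time 0; likewise for [b1] and [g]. *)
  destruct (exists_log_line (1 - x0) (x0 - y0) (p 4%nat + p 1%nat) c) as [b0 [Ib0 [Eb0 Db0]]];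
    [apply (HM (_, _)); cbn [List.In]; tauto|symmetry; exact Hp0|].
  destruct (exists_log_line (1 - x1) (x1 - y1) (p 0%nat + p 2%nat) c) as [b1 [Ib1 [Eb1 Db1]]];
    [apply (HM (_, _)); cbn [List.In]; tauto|symmetry; exact Hp1|].
  destruct (exists_log_line (x0 + x1 - 1) (y0 + y1 - x0 - x1) (p 0%nat + p 1%nat + p 3%nat) c)
    as [g [Ig [Eg Dg]]];
    [apply (HM (_, _)); cbn [List.In]; tauto|symmetry; exact Hp3|].
  (* The identities of [pentagon_exp] solved for [u_2], [u_3], [u_4] in logarithmic form. Indices
     from 5 on are frozen so that [U 0 = p] holds as functions. *)
  exists (fun t j => match j with
    | 0%nat => a0 t | 1%nat => a1 t | 2%nat => b1 t - a0 t | 3%nat => g t - a0 t - a1 t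
    | 4%nat => b0 t - a1 t | _ => p j end).
  split; [|split; [|split]].
  - extensionality j; do 5 (destruct j as [|j]; [rewrite ?Ia0, ?Ia1, ?Ib0, ?Ib1, ?Ig; ring|]).
    reflexivity.
  - intros t j Hj; unfold hatMT', pt.
    assert (N0 : x0 + arc c t * (y0 - x0) <> 0) by (rewrite <- Ea0; apply Cexp_neq_0).
    assert (N1 : x1 + arc c t * (y1 - x1) <> 0) by (rewrite <- Ea1; apply Cexp_neq_0).
    do 5 (destruct j as [|j]; [cbn -[Cexp Cplus RtoC Cminus];
      unfold Cminus; rewrite ?Cexp_plus, ?Cexp_opp, ?Ea0, ?Ea1, ?Eb0, ?Eb1, ?Eg;
      field; auto|]).
    lia.
  - intros j Hj t.
    destruct (Da0 t) as [da0 ?], (Da1 t) as [da1 ?], (Db0 t) as [db0 ?], (Db1 t) as [db1 ?],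
      (Dg t) as [dg ?].
    do 5 (destruct j as [|j];
      [eexists; repeat first [eassumption|eapply is_cderive_minus]|]).
    lia.
  - assert (N0 : y0 <> 0) by apply Cexp_neq_0.
    assert (N1 : y1 <> 0) by apply Cexp_neq_0.
    rewrite Cexp_plus in Hq0, Hq1; rewrite !Cexp_plus in Hq3; fold y0 y1 in Hq0, Hq1, Hq3.
    assert (R0 : x0 + 1 * (y0 - x0) = y0) by ring.
    assert (R1 : x1 + 1 * (y1 - x1) = y1) by ring.
    intros j Hj.
    destruct j as [|[|[|[|[|j]]]]]; [| | | | |lia];
      rewrite ?Cexp_minus, ?Ea0, ?Ea1, ?Eb0, ?Eb1, ?Eg, arc_PI, ?R0, ?R1.
    + reflexivity.
    + reflexivity.
    + replace (1 - x1 + _) with (1 - y1) by ring; rewrite Hq1.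
      field; exact N0.
    + replace (x0 + x1 - 1 + _) with (y0 + y1 - 1) by ring; rewrite Hq3.
      field; auto.
    + replace (1 - x0 + _) with (1 - y0) by ring; rewrite Hq0.
      field; exact N1.
Qed.

Lemma five_value_ext (tau : C * C -> (R * R -> Q) -> C) (u v : nat -> C) :
  (forall j, (j < 5)%nat -> u j = v j) -> five_value tau u = five_value tau v.
Proof.
  intros H; unfold five_value, prod5, pt; simpl.
  rewrite !H by lia; reflexivity.
Qed.

Lemma five_value_const (tau : C * C -> (R * R -> Q) -> C) (p q : nat -> C) :
  flat_section tau -> pentagon p -> pentagon q -> five_value tau p = five_value tau q.
Proof.
  intros Hflat Hp Hq.
  destruct (pentagon_curve p q Hp Hq) as [U [<- [HU [HD Hend]]]].
  rewrite (five_value_curve tau U 0 PI Hflat HU HD).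
  assert (Hn : exists n : nat -> Z, forall j, (j < 5)%nat ->
    U PI j = q j + two_pi_i * RtoC (IZR (n j))).
  { destruct (Cexp_inj _ _ (Hend 0%nat ltac:(lia))) as [n0 H0],
      (Cexp_inj _ _ (Hend 1%nat ltac:(lia))) as [n1 H1],
      (Cexp_inj _ _ (Hend 2%nat ltac:(lia))) as [n2 H2],
      (Cexp_inj _ _ (Hend 3%nat ltac:(lia))) as [n3 H3],
      (Cexp_inj _ _ (Hend 4%nat ltac:(lia))) as [n4 H4].
    exists (fun j => match j with 0 => n0 | 1 => n1 | 2 => n2 | 3 => n3 | _ => n4 end%nat).
    intros j Hj; do 5 (destruct j as [|j]; [assumption|]); lia. }
  destruct Hn as [n Hn].
  rewrite (five_value_ext tau _ _ Hn).
  apply five_value_deck; assumption.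
Qed.

(** * From five-term configurations to the function [L] *)

Lemma five_term_pt (p : nat -> C * C) :
  five_term p -> forall j, (j < 5)%nat -> p j = pt (fun j => fst (p j)) j.
Proof.
  intros H j Hj; destruct (H j Hj) as [_ Hs].
  unfold pt; rewrite <- Hs; apply surjective_pairing.
Qed.

Lemma five_term_pentagon (p : nat -> C * C) :
  five_term p -> pentagon (fun j => fst (p j)).
Proof.
  intros H j Hj; rewrite <- (five_term_pt p H j Hj); apply H, Hj.
Qed.

(** The normalization in [is_tau] says that [phi] times [hat_value] is 1 at each point. *)
Lemma ratio_five_value (tau : C * C -> (R * R -> Q) -> C) (phi : C * C -> C)
    (p : nat -> C * C) :
  is_ratio tau phi -> five_term p ->
  prod5 (fun j => phi (p j)) * five_value tau (fun j => fst (p j)) = 1.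
Proof.
  intros Hr Hp.
  assert (H : forall j, (j < 5)%nat ->
    phi (p j) * hat_value tau (pt (fun j => fst (p j)) j) = 1).
  { intros j Hj; rewrite <- (five_term_pt p Hp j Hj).
    apply (Hr (p j)), Hp, Hj. }
  unfold five_value, prod5.
  transitivity (
    (phi (p 0%nat) * hat_value tau (pt (fun j => fst (p j)) 0)) *
    (phi (p 1%nat) * hat_value tau (pt (fun j => fst (p j)) 1)) *
    (phi (p 2%nat) * hat_value tau (pt (fun j => fst (p j)) 2)) *
    (phi (p 3%nat) * hat_value tau (pt (fun j => fst (p j)) 3)) *
    (phi (p 4%nat) * hat_value tau (pt (fun j => fst (p j)) 4))); [ring|].
  rewrite !H by lia; ring.
Qed.

Lemma eq_mod_4pi2_of_Cexp (z w : C) :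
  Cexp (z / two_pi_i) = Cexp (w / two_pi_i) -> eq_mod_4pi2 z w.
Proof.
  intros H; destruct (Cexp_inj _ _ H) as [k Hk].
  pose proof two_pi_i_neq_0 as Hnz.
  (* The sign comes from [(2 pi i)^2 = - 4 pi^2]. *)
  exists (- k)%Z.
  transitivity (two_pi_i * (z / two_pi_i)); [field; exact Hnz|].
  rewrite Hk.
  transitivity (w + two_pi_i * two_pi_i * RtoC (IZR k)); [field; exact Hnz|].
  f_equal; rewrite opp_IZR; unfold two_pi_i.
  apply injective_projections; simpl; ring.
Qed.

Theorem theorem5p12 :
  forall L : C * C -> C, is_L L ->
  forall p q : nat -> C * C, five_term p -> five_term q ->
  eq_mod_4pi2
    (L (p 0%nat) + L (p 1%nat) + L (p 2%nat) + L (p 3%nat) + L (p 4%nat))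
    (L (q 0%nat) + L (q 1%nat) + L (q 2%nat) + L (q 3%nat) + L (q 4%nat)).
Proof.
  intros L [tau [phi [Hflat [_ [Hr HL]]]]] p q Hp Hq.
  apply eq_mod_4pi2_of_Cexp.
  assert (Hsum : forall r : nat -> C * C, five_term r ->
    Cexp ((L (r 0%nat) + L (r 1%nat) + L (r 2%nat) + L (r 3%nat) + L (r 4%nat)) / two_pi_i)
    = prod5 (fun j => phi (r j))).
  { intros r Hrt; unfold prod5.
    rewrite !HL by (apply Hrt; lia).
    rewrite <- !Cexp_plus; f_equal; field; apply two_pi_i_neq_0. }
  rewrite (Hsum p Hp), (Hsum q Hq).
  pose proof (ratio_five_value tau phi p Hr Hp) as Ep.
  pose proof (ratio_five_value tau phi q Hr Hq) as Eq.
  rewrite (five_value_const tau _ (fun j => fst (q j)) Hflat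
    (five_term_pentagon p Hp) (five_term_pentagon q Hq)) in Ep.
  (* Both products of values of [phi] are now inverse to the same [F], hence equal. *)
  set (F := five_value tau _) in *.
  transitivity (prod5 (fun j => phi (p j)) * (prod5 (fun j => phi (q j)) * F));
    [rewrite Eq; ring|].
  transitivity (prod5 (fun j => phi (q j)) * (prod5 (fun j => phi (p j)) * F)); [ring|].
  rewrite Ep; ring.
Qed.
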